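(* Let $N\ge 2$, $R>0$ and $B_R=\{x\in\mathbb{R}^N:|x|<R\}$. Let $g:\mathbb{R}\to\mathbb{R}$ be a locally Lipschitz continuous function. Assume that there is some $a>0$ such that $g$ is positive and convex on $[a,\infty)$, and that $g$ satisfies the Keller-Osserman condition. Then any solution $u\in C^2(B_R)$ of $$-\Delta u+g(u)=0\ \text{ in } B_R,\qquad \lim_{|x|\to R}u(x)=\infty,$$ is radially symmetric and increasing (i.e. $u(x)$ depends only on $|x|$ and is increasing as a function of $|x|$).
   Context: A solution $u$ is a classical solution in the open ball $B_R$, and the boundary condition means that $u(x)$ tends to $\infty$ uniformly as $|x|\to R$. Keller-Osserman condition: $g$ satisfies the Keller-Osserman condition if there exist $a>0$ and a nondecreasing function $h$ on $[a,\infty)$ such that $g\ge h$ on $[a,\infty)$ and $$\int_a^\infty\frac{ds}{\sqrt{H(s)}}<\infty,\qquad\text{where } H(s)=\int_a^s h(t)\,dt .$$ *)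

(* Defs.v *)
From HB Require Import structures.
From mathcomp Require Import all_boot all_order all_algebra.
From mathcomp Require Import all_classical all_reals all_analysis.

Set Implicit Arguments.
Unset Strict Implicit.
Unset Printing Implicit Defensive.

Import Order.TTheory GRing.Theory Num.Theory.
Import numFieldNormedType.Exports.

Local Open Scope classical_set_scope.
Local Open Scope ring_scope.

(* The library norm `|x| on row vectors is the sup norm; it induces the same
   topology, but |x| in the statement is the Euclidean norm. *)
Definition enorm (R : realType) (N : nat) (x : 'rV[R]_N) : R :=
  Num.sqrt (\sum_(i < N) x ord0 i ^+ 2).

Definition eball (R : realType) (N : nat) (r : R) : set 'rV[R]_N :=
  [set x | enorm x < r].

Definition basis_vec (R : realType) (N : nat) (i : 'I_N) : 'rV[R]_N :=
  delta_mx ord0 i.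

Definition partial (R : realType) (N : nat) (i : 'I_N) (u : 'rV[R]_N -> R) :
    'rV[R]_N -> R :=
  fun x => 'D_(basis_vec R i) u x.

(* Meant for open A: the values of u outside A are irrelevant. *)
Definition C1_on (R : realType) (N : nat) (A : set 'rV[R]_N)
    (u : 'rV[R]_N -> R) : Prop :=
  forall x, A x ->
    {for x, continuous u} /\
    forall i : 'I_N,
      derivable u x (basis_vec R i) /\ {for x, continuous (partial i u)}.

Definition C2_on (R : realType) (N : nat) (A : set 'rV[R]_N)
    (u : 'rV[R]_N -> R) : Prop :=
  C1_on A u /\ forall i : 'I_N, C1_on A (partial i u).

Definition laplacian (R : realType) (N : nat) (u : 'rV[R]_N -> R)
    (x : 'rV[R]_N) : R :=
  \sum_(i < N) partial i (partial i u) x.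

Definition locally_lipschitz (R : realType) (g : R -> R) : Prop :=
  forall x : R, exists2 U : set R, nbhs x U & [lipschitz g y | y in U].

(* The inverse is taken in \bar R, where 0^-1 = +oo, and Num.sqrt vanishes on
   negative reals; so a finite integral forces H > 0 almost everywhere on
   [a, +oo[, and h = 0 or H < 0 cannot satisfy the condition vacuously. *)
Definition keller_osserman (R : realType) (g : R -> R) : Prop :=
  exists a : R, exists h : R -> R,
    let H s := \int[lebesgue_measure]_(t in `[a, s]) h t in
    [/\ 0 < a,
        {in `[a, +oo[ &, {homo h : s t / s <= t}},
        {in `[a, +oo[, forall s, h s <= g s} &
        (\int[lebesgue_measure]_(s in `[a, +oo[) (Num.sqrt (H s))%:E^-1
          < +oo)%E].

Definition blows_up_at (R : realType) (N : nat) (rad : R)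
    (u : 'rV[R]_N -> R) : Prop :=
  forall M : R, \forall r \near rad^'-,
    forall x : 'rV[R]_N, enorm x = r -> M < u x.

Definition radial_increasing (R : realType) (N : nat) (rad : R)
    (u : 'rV[R]_N -> R) : Prop :=
  exists2 phi : R -> R,
    forall x, eball rad x -> u x = phi (enorm x) &
    {in `[0, rad[ &, {homo phi : r s / r < s}}.

(* Main.v *)
(* Moving planes.  Reflect [u] in the hyperplane [dot x e = k] with [0 < k] and compare
   it with [u] on the cap cut off from the ball.  The only difficulty is the corner
   where the hyperplane meets the sphere, since there both functions blow up.

   - The existence of a large solution forces [g] to be unbounded, hence, by
     convexity, increasing with a positive slope [c] beyond some value [b].
   - Near the boundary [u x - u y] is bounded above for [|x| < |y|]: maximise it over
     the pairs with [|y| >= tau |x|], where [tau] is a concave contraction slightly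
     larger than the identity, and use the tangential and radial second variations.
   - Hence the reflected solution exceeds [u] by a bounded amount at most.  By
     convexity [u - b + g b / c] is a supersolution of the linearised equation that
     blows up at the boundary, so this excess tends to zero there.
   - The gap between the two functions is thus controlled at the corner, and the
     maximum principle in narrow domains with the strong maximum principle
     let the hyperplane move until it reaches the centre. *)
Require Import Defs.
From HB Require Import structures.
From mathcomp Require Import all_boot all_order all_algebra.
From mathcomp Require Import all_classical all_reals all_analysis.
From mathcomp Require Import ring lra.

Set Implicit Arguments.
Unset Strict Implicit.
Unset Printing Implicit Defensive.

Import Order.TTheory GRing.Theory Num.Theory.
Import numFieldNormedType.Exports.

Local Open Scope classical_set_scope.
Local Open Scope ring_scope.

(** At the corner a comparison would oppose two infinite values. Since [tau] exceeds the identity by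
    at least [t / 4], the constraint on the pairs keeps [x] in a fixed smaller ball while [u y]
    blows up, so the maximum of [u x - u y] is attained. The resulting bound does not involve [t],
    hence [t] can be fitted to any given pair.

    At such a maximum the two points need not be aligned. Rotating each on its own sphere bounds the
    Laplacians by radial expressions; their curvature terms, over [|x|] and over [|y|], do not
    cancel, and the negative second derivative of [tau] pays for the difference.

    Since [u] is unbounded, no Lipschitz constant of [g] need serve the whole ball; the weighted
    maximum principle asks only for a one-sided one, which monotonicity beyond [b] provides.

    The hyperplane at distance [rad] cuts off an empty cap, so the step that moves the hyperplane
    inwards also starts the motion.

    All extremum tests reduce to the one-variable second-derivative test along lines, radii and
    great circles. *)

Lemma is_derive_line (R : realType) (V : normedModType R) (f : V -> R)
    (y v : V) (s : R) :
  derivable f (s *: v + y) v ->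
  is_derive s 1 (fun r : R => f (r *: v + y)) ('D_v f (s *: v + y)).
Proof.
have E : (fun h : R => h^-1 *: (((fun r : R => f (r *: v + y)) \o shift s) (h *: 1)
             - f (s *: v + y)))
       = (fun h : R => h^-1 *: ((f \o shift (s *: v + y)) (h *: v)
             - f (s *: v + y))).
  by apply/funext => h /=; rewrite [h%:A]mulr1 scalerDl addrA.
move=> df; apply: DeriveDef; first by rewrite /derivable E.
by rewrite /derive E.
Qed.

Lemma MVT_from0 (R : realType) (f df : R -> R) (c : R) :
  (forall x : R, `|x| <= `|c| -> is_derive x 1 f (df x)) ->
  exists2 x, `|x| <= `|c| & f c - f 0 = df x * c.
Proof.
move=> fE.
have fC x : `|x| <= `|c| -> {for x, continuous f}.
  move=> xc; apply/differentiable_continuous/derivable1_diffP.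
  by have [] := fE x xc.
have [c0|c0] := leP 0 c.
- have inI x : 0 <= x <= c -> `|x| <= `|c| by move=> /andP[? ?]; rewrite !ger0_norm; lra.
  have [] := @MVT_segment R f df 0 c c0.
  + by move=> x /[!in_itv]/= xI; apply/fE/inI; lra.
  + apply: continuous_in_subspaceT => x /[!inE]/= /[!in_itv]/= xI.
    exact/fC/inI.
  + move=> x /[!in_itv]/= xI; rewrite subr0 => e; exists x => //; exact: inI.
- have inI x : c <= x <= 0 -> `|x| <= `|c|.
    by move=> /andP[? ?]; rewrite !ler0_norm; lra.
  have [] := @MVT_segment R f df c 0 (ltW c0).
  + by move=> x /[!in_itv]/= xI; apply/fE/inI; lra.
  + apply: continuous_in_subspaceT => x /[!inE]/= /[!in_itv]/= xI.
    exact/fC/inI.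
  + move=> x /[!in_itv]/= xI e; exists x; first exact: inI.
    lra.
Qed.

Lemma cvg_sumr (R : realType) (T : Type) (F : set_system T) (I : Type)
    (r : seq I) (f : I -> T -> R) (l : I -> R) :
  Filter F -> (forall i, f i x @[x --> F] --> l i) ->
  \sum_(i <- r) f i x @[x --> F] --> \sum_(i <- r) l i.
Proof. by move=> FF fl; apply: cvg_big => //; exact: add_continuous. Qed.

(** * Total differentiability and the chain rule from continuous partial derivatives *)

Section chain_rule.
Variables (R : realType) (N : nat).
Implicit Types (u : 'rV[R]_N -> R) (x y v : 'rV[R]_N) (A : set 'rV[R]_N).

Definition directional u x v : R := \sum_(i < N) v ord0 i * partial i u x.

Let directional_linear u x : linear (directional u x).
Proof.
move=> k v w; rewrite /directional scaler_sumr -big_split/=.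
by apply: eq_bigr => i _; rewrite !mxE mulrDl -mulrA.
Qed.

Definition truncated (h : 'rV[R]_N) (k : nat) : 'rV[R]_N :=
  \row_i (if (i < k)%N then h ord0 i else 0).

Lemma rV_norm_ge (h : 'rV[R]_N) (i : 'I_N) : `|h ord0 i| <= `|h|.
Proof. by rewrite {2}/Num.norm/= mx_normrE; exact: (le_bigmax _ _ (ord0, i)). Qed.

Lemma rV_norm_le (h : 'rV[R]_N) (e : R) :
  0 <= e -> (forall i, `|h ord0 i| <= e) -> `|h| <= e.
Proof.
move=> e0 he; rewrite {1}/Num.norm/= mx_normrE (bigmax_le _ e0)//= => -[i j] _.
by rewrite ord1.
Qed.

(** The increment is telescoped through the points [truncated h k], which change one coordinate at a
    time, and the mean value theorem is applied to each step. The points met stay within sup-norm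
    distance [|h|] of [x], where all partial derivatives are close to their values at [x]. *)
Lemma C1_on_increment A u x (e : R) : nbhs x A -> C1_on A u -> 0 < e ->
  \forall h \near (0 : 'rV[R]_N),
    `|u (h + x) - u x - directional u x h| <= e * `|h|.
Proof.
move=> xA uC1 e0.
have Ax : A x := nbhs_singleton xA.
(* There are [N] one-coordinate errors of size [d * |h|]; the divisor [N.+1] is nonzero even for
   [N = 0]. *)
pose d := e / N.+1%:R; have d0 : 0 < d by rewrite divr_gt0.
have dP i : \forall y \near x, `|partial i u x - partial i u y| <= d.
  by have [_ /(_ i)[_ /cvgrPdist_le/(_ _ d0)]] := uC1 x Ax.
have : \forall y \near x, A y /\ forall i, `|partial i u x - partial i u y| <= d.
  by apply: filterI => //; exact: filter_forall dP.
move=> /nbhs_ballP[r /= r0 rP]; near=> h.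
have hr : `|h| < r by near: h; apply: cvgr0_norm_lt.
have zP (z : 'rV[R]_N) : (forall i, `|z ord0 i| <= `|h|) ->
    A (z + x) /\ forall i, `|partial i u x - partial i u (z + x)| <= d.
  move=> zh; apply: rP; rewrite -ball_normE/= opprD addrCA subrr addr0 normrN.
  by apply: le_lt_trans hr; apply: rV_norm_le.
have T0 : truncated h 0 = 0 by apply/rowP => i; rewrite !mxE.
have TN : truncated h N = h by apply/rowP => i; rewrite !mxE ltn_ord.
have step (i : 'I_N) :
    `|u (truncated h i.+1 + x) - u (truncated h i + x)
      - h ord0 i * partial i u x| <= d * `|h|.
  have hi := rV_norm_ge h i.
  have coord (s : R) : `|s| <= `|h ord0 i| -> forall j,
      `|(s *: basis_vec R i + truncated h i) ord0 j| <= `|h|.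
    move=> sh j; rewrite !mxE eqxx/=; have [->|ji] := eqVneq j i.
      by rewrite ltnn mulr1 addr0 (le_trans sh).
    by rewrite mulr0 add0r; case: ifP => _; rewrite ?normr0//; apply: rV_norm_ge.
  have TS : truncated h i.+1 = h ord0 i *: basis_vec R i + truncated h i.
    apply/rowP => j; rewrite !mxE eqxx/= ltnS.
    have [->|ji] := eqVneq j i; first by rewrite leqnn ltnn mulr1 addr0.
    by rewrite leq_eqVlt (inj_eq val_inj) (negbTE ji)/= mulr0 add0r.
  have [s sh sE] := @MVT_from0 R (fun s => u (s *: basis_vec R i + (truncated h i + x)))
    (fun s => partial i u (s *: basis_vec R i + (truncated h i + x))) (h ord0 i)
    (fun s sh => is_derive_line (proj1 (proj2 (uC1 _
       (eq_ind_r A (proj1 (zP _ (coord s sh))) (addrA _ _ _))) i))).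
  rewrite TS -[_ *: _ + _ + x]addrA; move: sE; rewrite scale0r add0r => ->.
  have [_ /(_ i)] := zP _ (coord s sh); rewrite -addrA => sd.
  rewrite mulrC -mulrBr normrM mulrC; apply: ler_pM => //.
  by rewrite distrC.
have -> : u (h + x) - u x - directional u x h =
    \sum_(i < N) (u (truncated h i.+1 + x) - u (truncated h i + x)
                  - h ord0 i * partial i u x).
  rewrite big_split/= sumrN; congr (_ - _).
  rewrite -(big_mkord xpredT (fun i => u (truncated h i.+1 + x) - u (truncated h i + x))).
  by rewrite telescope_sumr// T0 TN add0r.
apply: le_trans (ler_norm_sum _ _ _) _.
apply: le_trans (ler_sum _ (fun i _ => step i)) _.
rewrite sumr_const card_ord -mulr_natr mulrAC ler_wpM2r//.
by rewrite /d mulrAC ler_pdivrMr// ler_wpM2l ?ler_nat// ltW.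
Unshelve. all: by end_near. Qed.

Lemma C1_on_differentiable A u x : nbhs x A -> C1_on A u ->
  differentiable u x /\ 'd u x = directional u x :> ('rV[R]_N -> R).
Proof.
move=> xA uC1.
pose dM := GRing.isLinear.Build _ _ _ _ _ (directional_linear u x).
pose dL : {linear 'rV[R]_N -> R} := HB.pack (directional u x) dM.
have dC : continuous dL.
  move=> y; rewrite /= /directional.
  apply: (@cvg_sumr R _ (nbhs y)) => i; apply: cvgM; last exact: cvg_cst.
  exact: coord_continuous.
have uE : u \o shift x = cst (u x) + dL +o_ (0 : 'rV[R]_N) id.
  apply/eqaddoP => e e0.
  have := C1_on_increment xA uC1 e0; apply: filterS => h.
  by rewrite /= !fctE/= opprD addrA.
have dE := diff_unique dC uE; split => //.
by apply/diff_locallyP; rewrite dE; split.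
Qed.

Lemma C1_on_curve A u (gam : R -> 'rV[R]_N) v (t : R) :
  nbhs (gam t) A -> C1_on A u ->
  (forall i, is_derive t 1 (fun s => gam s ord0 i) (v ord0 i)) ->
  is_derive t 1 (u \o gam) (directional u (gam t) v).
Proof.
move=> gA uC1 gE.
have [du dE] := C1_on_differentiable gA uC1.
have dg : derivable gam t 1.
  by apply/derivable_mxP => i j; rewrite ord1; have [] := gE j.
have dg' : differentiable gam t by apply/derivable1_diffP.
have dc : differentiable (u \o gam) t by exact: differentiable_comp.
apply: DeriveDef; first exact/derivable1_diffP.
rewrite deriveE// diff_comp//= dE -deriveE//; congr (directional u _ _).
rewrite derive_mx//; apply/rowP => j; rewrite mxE.
by have [_ ->] := gE j.
Qed.

End chain_rule.

(** * Second-order jets along curves *)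

Section second_order_jets.
Variable R : realType.
Implicit Types (f g : R -> R) (a b c d k : R).

(** First and second derivative at 0 in the weakest form that a second-derivative test can use: a
    first derivative near 0, itself differentiable at the single point 0. *)
Definition has_jet2 f a b : Prop :=
  exists2 f1 : R -> R,
    (\forall t \near (0 : R), is_derive (t : R) 1 f (f1 t)) /\ f1 0 = a &
    is_derive (0 : R) 1 f1 b.

Lemma has_jet2_derive f a b : has_jet2 f a b -> is_derive (0 : R) 1 f a.
Proof. by move=> [f1 [/nbhs_singleton + <-]]. Qed.

Lemma has_jet2_eq f a b a' b' : has_jet2 f a b -> a = a' -> b = b' ->
  has_jet2 f a' b'.
Proof. by move=> ? <- <-. Qed.

Lemma has_jet2_cst c : has_jet2 (fun=> c) 0 0.
Proof.
exists (fun=> 0); last exact: is_derive_cst.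
by split => //; apply: (@nearW _ (nbhs (0 : R))) => t; exact: is_derive_cst.
Qed.

Lemma has_jet2_id : has_jet2 (fun t => t) 1 0.
Proof.
exists (fun=> 1); last exact: is_derive_cst.
by split => //; apply: (@nearW _ (nbhs (0 : R))) => t; exact: is_derive_id.
Qed.

Lemma has_jet2D f g a b c d : has_jet2 f a b -> has_jet2 g c d ->
  has_jet2 (fun t => f t + g t) (a + c) (b + d).
Proof.
move=> [f1 [fE <-] f1E] [g1 [gE <-] g1E].
exists (fun t => f1 t + g1 t); last exact: (is_deriveD f1E g1E).
by split => //; apply: filterS2 fE gE => t dft dgt; exact: (is_deriveD dft dgt).
Qed.

Lemma has_jet2M f g a b c d : has_jet2 f a b -> has_jet2 g c d ->
  has_jet2 (fun t => f t * g t) (f 0 * c + g 0 * a)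
    (f 0 * d + g 0 * b + a * c *+ 2).
Proof.
move=> [f1 [fE <-] f1E] [g1 [gE <-] g1E].
exists (fun t => f t * g1 t + g t * f1 t).
  split => //; apply: filterS2 fE gE => t dft dgt.
  exact: (is_deriveM dft dgt).
have df := nbhs_singleton fE; have dg := nbhs_singleton gE.
apply: is_derive_eq (is_deriveD (is_deriveM df g1E) (is_deriveM dg f1E)) _.
by rewrite /GRing.scale/=; ring.
Qed.

Lemma has_jet2Z k f a b : has_jet2 f a b -> has_jet2 (fun t => k * f t) (k * a) (k * b).
Proof.
move=> /(has_jet2M (has_jet2_cst k))/has_jet2_eq; apply; ring.
Qed.

Lemma has_jet2N f a b : has_jet2 f a b -> has_jet2 (fun t => - f t) (- a) (- b).
Proof.
move=> [f1 [fE <-] f1E]; exists (fun t => - f1 t); last exact: (is_deriveN f1E).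
by split => //; apply: filterS fE => t dft; exact: (is_deriveN dft).
Qed.

Lemma has_jet2B f g a b c d : has_jet2 f a b -> has_jet2 g c d ->
  has_jet2 (fun t => f t - g t) (a - c) (b - d).
Proof. by move=> fE /has_jet2N gE; exact: has_jet2D. Qed.

Lemma has_jet2_sin k : has_jet2 (fun t => sin (k * t)) k 0.
Proof.
have dk (t : R) : is_derive t 1 (fun t => k * t) k.
  by apply: is_derive_eq (is_deriveZ k (is_derive_id t (1 : R))) _; rewrite /GRing.scale/= mulr1.
exists (fun t => k * cos (k * t)).
  split; last by rewrite mulr0 cos0 mulr1.
  apply: (@nearW _ (nbhs (0 : R))) => t.
  by apply: is_derive_eq (is_derive1_comp (is_derive_sin (k * t)) (dk t)) _; rewrite mulrC.
apply: is_derive_eq (is_deriveZ k (is_derive1_comp (is_derive_cos (k * 0)) (dk 0))) _.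
by rewrite mulr0 sin0 /GRing.scale/=; ring.
Qed.

Lemma has_jet2_cos k : has_jet2 (fun t => cos (k * t)) 0 (- k ^+ 2).
Proof.
have dk (t : R) : is_derive t 1 (fun t => k * t) k.
  by apply: is_derive_eq (is_deriveZ k (is_derive_id t (1 : R))) _; rewrite /GRing.scale/= mulr1.
exists (fun t => - k * sin (k * t)).
  split; last by rewrite mulr0 sin0 mulr0.
  apply: (@nearW _ (nbhs (0 : R))) => t.
  by apply: is_derive_eq (is_derive1_comp (is_derive_cos (k * t)) (dk t)) _; ring.
apply: is_derive_eq (is_deriveZ (- k) (is_derive1_comp (is_derive_sin (k * 0)) (dk 0))) _.
by rewrite mulr0 cos0 /GRing.scale/=; ring.
Qed.

Lemma is_derive_gt0_right f a : is_derive (0 : R) 1 f a -> 0 < a ->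
  \forall t \near (0 : R)^'+, f 0 < f t.
Proof.
move=> [df <-] a0.
have {}df : (fun h => h^-1 *: ((f \o shift 0) (h *: 1) - f 0)) @ (0 : R)^'
    --> 'D_1 f 0 by exact: df.
have /cvgr_gt/(_ 0 a0) q0 := cvg_dnbhs_at_right df.
near=> t.
have t0 : 0 < t by near: t; exact: nbhs_right_gt.
have : 0 < t^-1 *: ((f \o shift 0) (t *: 1) - f 0) by near: t.
by rewrite /= addr0 [t%:A]mulr1 /GRing.scale/= pmulr_rgt0 ?invr_gt0// subr_gt0.
Unshelve. all: by end_near. Qed.

Lemma has_jet2_right_le f a b : has_jet2 f a b ->
  (\forall t \near (0 : R)^'+, f t <= f 0) -> a <= 0.
Proof.
move=> /has_jet2_derive df fmax; rewrite leNgt; apply/negP => a0.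
near (0 : R)^'+ => t.
have : f 0 < f t by near: t; exact: is_derive_gt0_right df a0.
by rewrite ltNge => /negP; apply; near: t.
Unshelve. all: by end_near. Qed.

(** A positive [b] would make the first derivative, which vanishes at 0, positive just to the right
    of 0; by the mean value theorem [f] would exceed [f 0] there. *)
Lemma has_jet2_max f a b : has_jet2 f a b ->
  (\forall t \near (0 : R), f t <= f 0) -> a = 0 /\ b <= 0.
Proof.
move=> jf fmax.
have [f1 [fE f10] f1E] := jf.
have [d d0 dP] : exists2 d : R, 0 < d &
    forall t, `|t| < d -> is_derive (t : R) 1 f (f1 t) /\ f t <= f 0.
  have {}/nbhs_ballP[d /= d0 dP] : \forall t \near (0 : R),
    is_derive (t : R) 1 f (f1 t) /\ f t <= f 0 by exact: filterI fE fmax.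
  by exists d => // t td; apply: dP; rewrite -ball_normE/= sub0r normrN.
have oo t : t \in `]-d, d[%R -> `|t| < d by rewrite in_itv/= ltr_norml.
have a0 : a = 0.
  have : is_derive (0 : R) 1 f 0.
    apply: (@derive1_at_max _ f (- d) d).
    - by lra.
    - by move=> t /oo/dP[[]].
    - by rewrite in_itv/=; lra.
    - by move=> t /oo/dP[].
  by case => _ <-; have [_ <-] := has_jet2_derive jf.
split => //; rewrite leNgt; apply/negP => b0.
have := is_derive_gt0_right f1E b0.
rewrite f10 a0 => f1_gt0.
have [e e0 eP] : exists2 e : R, 0 < e & forall t, 0 < t < e -> 0 < f1 t.
  have [e /= e0 eP] := f1_gt0; exists e => // t /andP[t0 te].
  by apply: eP => //=; rewrite sub0r normrN gtr0_norm.
pose m := Num.min d e / 2.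
have m0 : 0 < m by rewrite divr_gt0// lt_min d0.
have md : m < d by rewrite /m; have := @ge_min _ _ d d e; rewrite lexx/=; lra.
have me : m < e by rewrite /m; have := @ge_min _ _ e d e; rewrite lexx orbT/=; lra.
have [] := @MVT R f f1 0 m m0.
- move=> t /[!in_itv]/= /andP[t0 tm]; apply: (dP t _).1.
  by rewrite gtr0_norm//; lra.
- apply: continuous_in_subspaceT => t /[!inE]/= /[!in_itv]/= /andP[t0 tm].
  apply/differentiable_continuous/derivable1_diffP.
  by have [] := (dP t _).1; rewrite // ger0_norm//; lra.
- move=> t /[!in_itv]/= /andP[t0 tm]; rewrite subr0 => E.
  have : 0 < f1 t * m by rewrite mulr_gt0// eP// t0; lra.
  rewrite -E subr_gt0 ltNge => /negP; apply; apply: (dP m _).2.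
  by rewrite gtr0_norm.
Qed.

End second_order_jets.

Section jets_along_curves.
Variables (R : realType) (N : nat).
Implicit Types (u : 'rV[R]_N -> R) (x v w : 'rV[R]_N) (A : set 'rV[R]_N).

Definition hessian u x v : R :=
  \sum_(i < N) v ord0 i * directional (partial i u) x v.

Lemma C2_on_jet2 A u (gam : R -> 'rV[R]_N) v w :
  open A -> C2_on A u -> A (gam 0) ->
  (forall i, has_jet2 (fun t => gam t ord0 i) (v ord0 i) (w ord0 i)) ->
  has_jet2 (u \o gam) (directional u (gam 0) v)
    (hessian u (gam 0) v + directional u (gam 0) w).
Proof.
move=> oA [uC1 uC2] Ag gE.
have gam_cont : {for 0, continuous gam}.
  apply/differentiable_continuous/derivable1_diffP.
  by apply/derivable_mxP => i j; rewrite ord1; have [] := has_jet2_derive (gE j).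
have gA : \forall t \near (0 : R), A (gam t).
  by apply: gam_cont; exact: open_nbhs_nbhs.
have /choice[f1 f1P] : forall i, exists f1 : R -> R,
    (\forall t \near (0 : R), is_derive (t : R) 1 (fun t => gam t ord0 i) (f1 t))
    /\ f1 0 = v ord0 i /\ is_derive (0 : R) 1 f1 (w ord0 i).
  by move=> i; have [f1 [? ?] ?] := gE i; exists f1.
pose gam1 t : 'rV[R]_N := \row_i f1 i t.
have gam10 : gam1 0 = v by apply/rowP => i; rewrite mxE; have [_ []] := f1P i.
exists (fun t => directional u (gam t) (gam1 t)).
  split; last by rewrite gam10.
  have /filter_forall near1 := fun i => (f1P i).1.
  apply: filterS2 gA near1 => t At t1.
  apply: (C1_on_curve _ uC1) => [|i]; first exact: open_nbhs_nbhs.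
  by rewrite mxE; exact: t1.
have dE i : is_derive (0 : R) 1 (fun t => gam1 t ord0 i * partial i u (gam t))
    (v ord0 i * directional (partial i u) (gam 0) v
     + w ord0 i * partial i u (gam 0)).
  have d1 : is_derive (0 : R) 1 (fun t => gam1 t ord0 i) (w ord0 i).
    rewrite (_ : (fun t => _) = f1 i); first by have [_ []] := f1P i.
    by apply/funext => t; rewrite mxE.
  have d2 : is_derive (0 : R) 1 (partial i u \o gam)
      (directional (partial i u) (gam 0) v).
    apply: (C1_on_curve _ (uC2 i)) => [|j]; first exact: open_nbhs_nbhs.
    exact: has_jet2_derive (gE j).
  apply: is_derive_eq (is_deriveM d1 d2) _.
  by rewrite gam10 /GRing.scale/= [X in _ + X]mulrC.
rewrite [X in is_derive _ _ X _](_ : _ =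
    \sum_(i < N) (fun t => gam1 t ord0 i * partial i u (gam t))); last first.
  by apply/funext => t; rewrite fct_sumE.
apply: is_derive_eq (is_derive_sum dE) _.
by rewrite big_split.
Qed.

(** Curves in the span of two fixed vectors cover all the variations used: straight lines, rescaled
    radii and great circles. *)
Lemma C2_on_jet2_comb A u (p q : R -> R) (a b c d : R) x y :
  open A -> C2_on A u -> A (p 0 *: x + q 0 *: y) ->
  has_jet2 p a b -> has_jet2 q c d ->
  has_jet2 (fun t => u (p t *: x + q t *: y))
    (directional u (p 0 *: x + q 0 *: y) (a *: x + c *: y))
    (hessian u (p 0 *: x + q 0 *: y) (a *: x + c *: y)
     + directional u (p 0 *: x + q 0 *: y) (b *: x + d *: y)).
Proof.
move=> oA uC2 A0 pE qE.
apply: (@C2_on_jet2 A u (fun t => p t *: x + q t *: y)) => // i.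
rewrite (_ : (fun t => _) = (fun t => x ord0 i * p t + y ord0 i * q t)); last first.
  by apply/funext => t; rewrite !mxE mulrC [X in _ + X]mulrC.
apply: has_jet2_eq (has_jet2D (has_jet2Z _ pE) (has_jet2Z _ qE)) _ _.
  by rewrite !mxE mulrC [X in _ + X]mulrC.
by rewrite !mxE mulrC [X in _ + X]mulrC.
Qed.

End jets_along_curves.

(** * Euclidean geometry and the Laplacian *)

Section euclidean_geometry.
Variables (R : realType) (N : nat).
Implicit Types (x y z v w e : 'rV[R]_N) (k r : R).

Definition dot x y : R := \sum_(i < N) x ord0 i * y ord0 i.

Lemma dotC x y : dot x y = dot y x.
Proof. by apply: eq_bigr => i _; rewrite mulrC. Qed.

Lemma dotDl x y z : dot (x + y) z = dot x z + dot y z.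
Proof. by rewrite -big_split; apply: eq_bigr => i _; rewrite mxE mulrDl. Qed.

Lemma dotZl k x y : dot (k *: x) y = k * dot x y.
Proof. by rewrite mulr_sumr; apply: eq_bigr => i _; rewrite mxE mulrA. Qed.

Lemma dotDr x y z : dot z (x + y) = dot z x + dot z y.
Proof. by rewrite dotC dotDl !(dotC z). Qed.

Lemma dotZr k x y : dot y (k *: x) = k * dot y x.
Proof. by rewrite dotC dotZl dotC. Qed.

Lemma dotNl x y : dot (- x) y = - dot x y.
Proof. by rewrite -scaleN1r dotZl mulN1r. Qed.

Lemma dotNr x y : dot y (- x) = - dot y x.
Proof. by rewrite dotC dotNl dotC. Qed.

Definition dotE := (dotDl, dotDr, dotZl, dotZr, dotNl, dotNr).

Lemma dot0l x : dot 0 x = 0.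
Proof. by rewrite -[0](scale0r (0 : 'rV_N)) dotZl mul0r. Qed.

Lemma dot_basis x i : dot x (basis_vec R i) = x ord0 i.
Proof.
rewrite /dot (bigD1 i)//= big1 => [|j ji]; rewrite !mxE !eqxx/= ?mulr1 ?addr0//.
by rewrite (negbTE ji) mulr0.
Qed.

Lemma basis_diag (i : 'I_N) : basis_vec R i ord0 i = 1.
Proof. by rewrite mxE !eqxx. Qed.

Lemma dot_ge0 x : 0 <= dot x x.
Proof. by apply: sumr_ge0 => i _; rewrite -expr2 sqr_ge0. Qed.

Lemma dot_eq0 x : dot x x = 0 -> x = 0.
Proof.
move=> /eqP; rewrite psumr_eq0 => [/allP x0|i _]; last by rewrite -expr2 sqr_ge0.
apply/rowP => i; rewrite mxE; apply/eqP; rewrite -sqrf_eq0 expr2.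
by apply: (x0 i); rewrite mem_index_enum.
Qed.

Lemma dot_gt0 x : x != 0 -> 0 < dot x x.
Proof.
by move=> x0; rewrite lt0r dot_ge0 andbT; apply: contra_neq x0; exact: dot_eq0.
Qed.

Lemma enormE x : enorm x = Num.sqrt (dot x x).
Proof. by congr Num.sqrt; apply: eq_bigr => i _; rewrite expr2. Qed.

Lemma enorm_ge0 x : 0 <= enorm x.
Proof. by rewrite enormE sqrtr_ge0. Qed.

Lemma enorm_sqr x : enorm x ^+ 2 = dot x x.
Proof. by rewrite enormE sqr_sqrtr// dot_ge0. Qed.

Lemma enormZ k x : enorm (k *: x) = `|k| * enorm x.
Proof. by rewrite !enormE !dotE mulrA -expr2 sqrtrM ?sqr_ge0// sqrtr_sqr. Qed.

Lemma enorm_eq0 x : enorm x = 0 -> x = 0.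
Proof. by move=> x0; apply: dot_eq0; rewrite -enorm_sqr x0 expr0n. Qed.

Lemma enorm_ler_sqr x r : 0 <= r -> (enorm x <= r) = (dot x x <= r ^+ 2).
Proof. by move=> r0; rewrite -enorm_sqr ler_sqr// nnegrE enorm_ge0. Qed.

Lemma enorm_ltr_sqr x r : 0 <= r -> (enorm x < r) = (dot x x < r ^+ 2).
Proof. by move=> r0; rewrite -enorm_sqr ltr_sqr// nnegrE enorm_ge0. Qed.

Lemma enorm_eqr_sqr x r : 0 <= r -> dot x x = r ^+ 2 -> enorm x = r.
Proof. by move=> r0 xr; rewrite enormE xr sqrtr_sqr ger0_norm. Qed.

Lemma dot_sqr_le x e : dot e e = 1 -> dot x e ^+ 2 <= dot x x.
Proof.
move=> e1; rewrite -subr_ge0.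
have -> : dot x x - dot x e ^+ 2 = dot (x - dot x e *: e) (x - dot x e *: e).
  by rewrite !dotE e1 (dotC e x); ring.
exact: dot_ge0.
Qed.

Lemma dot_le_enorm x e : dot e e = 1 -> dot x e <= enorm x.
Proof.
move=> e1; apply: le_trans (ler_norm _) _.
rewrite -(ler_sqr (normr_ge0 _) (enorm_ge0 x)) enorm_sqr real_normK ?num_real//.
exact: dot_sqr_le.
Qed.

Lemma dot_le_enormM x y : dot x y <= enorm x * enorm y.
Proof.
have [->|y0] := eqVneq y 0.
  by rewrite dotC dot0l mulr_ge0// enorm_ge0.
have yn : 0 < enorm y.
  rewrite lt0r enorm_ge0 andbT; apply: contra_neq y0; exact: enorm_eq0.
pose e := (enorm y)^-1 *: y.
have yE : y = enorm y *: e by rewrite scalerA mulfV ?gt_eqF// scale1r.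
rewrite {1}yE dotZr mulrC ler_pM2r//; apply: dot_le_enorm.
rewrite /e !dotE -enorm_sqr; field; exact: lt0r_neq0.
Qed.

Lemma enormD x y : enorm (x + y) <= enorm x + enorm y.
Proof.
rewrite enorm_ler_sqr ?addr_ge0 ?enorm_ge0// !dotE (dotC y x) sqrrD !enorm_sqr.
have := dot_le_enormM x y; set p := enorm x * enorm y => H.
by rewrite -[leRHS]/(dot x x + p *+ 2 + dot y y); lra.
Qed.

Lemma enormN x : enorm (- x) = enorm x.
Proof. by rewrite -scaleN1r enormZ normrN normr1 mul1r. Qed.

Lemma cvg_dot (T : Type) (F : set_system T) (f g : T -> 'rV[R]_N) x y :
  Filter F -> f @ F --> x -> g @ F --> y -> dot (f t) (g t) @[t --> F] --> dot x y.
Proof.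
move=> FF fx gy; apply: cvg_sumr => i; apply: cvgM.
  exact: (cvg_comp _ _ fx (@coord_continuous _ _ _ ord0 i x)).
exact: (cvg_comp _ _ gy (@coord_continuous _ _ _ ord0 i y)).
Qed.

Lemma cvg_enorm (T : Type) (F : set_system T) (f : T -> 'rV[R]_N) x :
  Filter F -> f @ F --> x -> enorm (f t) @[t --> F] --> enorm x.
Proof.
move=> FF fx; rewrite (_ : (fun t => _) = (fun t => Num.sqrt (dot (f t) (f t)))).
  rewrite enormE; apply: (cvg_comp (fun t => dot (f t) (f t)) Num.sqrt).
    exact: (cvg_dot FF fx fx).
  exact: sqrt_continuous.
by apply/funext => t; rewrite enormE.
Qed.

Lemma dot_continuousr e : continuous (fun x => dot x e).
Proof. by move=> x; apply: (@cvg_dot _ (nbhs x) id (cst e)); [exact: cvg_id|exact: cvg_cst]. Qed.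

Lemma enorm_continuous : continuous (@enorm R N).
Proof. by move=> x; apply: (@cvg_enorm _ (nbhs x) id); exact: cvg_id. Qed.

Lemma eball_open r : open (@eball R N r).
Proof.
rewrite (_ : eball r = @enorm R N @^-1` [set s | s < r])//.
by apply: open_comp => [x _|]; [exact: enorm_continuous|exact: open_lt].
Qed.

Lemma rV_norm_le_enorm x : `|x| <= enorm x.
Proof.
apply: rV_norm_le; first exact: enorm_ge0.
move=> i; rewrite -(ger0_norm (enorm_ge0 x)) -ler_sqr ?nnegrE// real_normK ?num_real//.
rewrite real_normK ?num_real// enorm_sqr /dot (bigD1 i)//= -expr2 lerDl.
by apply: sumr_ge0 => j _; rewrite -expr2 sqr_ge0.
Qed.

Lemma closed_le_compact r (C : set 'rV[R]_N) :
  closed C -> (forall x, C x -> enorm x <= r) -> compact C.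
Proof.
move=> cC Cr; apply: bounded_closed_compact => //.
exists r; split; first exact: num_real.
move=> s rs x /Cr xr; apply: le_trans (rV_norm_le_enorm x) _.
by apply: le_trans xr _; exact: ltW.
Qed.

Lemma cvg_line (x v : 'rV[R]_N) : x + t *: v @[t --> (0 : R)] --> x.
Proof.
rewrite -[X in _ --> X]addr0; apply: cvgD; first exact: cvg_cst.
rewrite -(scale0r v); apply: cvgZr_tmp; exact: cvg_id.
Qed.

End euclidean_geometry.

Section laplacian_jets.
Variables (R : realType) (N : nat).
Implicit Types (x y v w e : 'rV[R]_N) (f g u : 'rV[R]_N -> R) (k l m : R).
Implicit Types (A : set 'rV[R]_N).

(** A relation at one point, built from jets along the coordinate lines. It passes through sums and
    multiples and applies to barriers and reflected functions without any regularity on an open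
    set. *)
Definition has_laplacian f x l : Prop :=
  exists2 ab : 'I_N -> R * R,
    forall i, has_jet2 (fun t => f (x + t *: basis_vec R i)) (ab i).1 (ab i).2 &
    \sum_(i < N) (ab i).2 = l.

Lemma has_laplacian_eq f x l l' : has_laplacian f x l -> l = l' -> has_laplacian f x l'.
Proof. by move=> + <-. Qed.

Lemma has_laplacianB f g x l m : has_laplacian f x l -> has_laplacian g x m ->
  has_laplacian (fun y => f y - g y) x (l - m).
Proof.
move=> [ab fE <-] [cd gE <-].
exists (fun i => ((ab i).1 - (cd i).1, (ab i).2 - (cd i).2)) => [i|] /=.
  exact: has_jet2B.
by rewrite big_split/= sumrN.
Qed.

Lemma has_laplacianZ k f x l : has_laplacian f x l ->
  has_laplacian (fun y => k * f y) x (k * l).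
Proof.
move=> [ab fE <-]; exists (fun i => (k * (ab i).1, k * (ab i).2)) => [i|] /=.
  exact: has_jet2Z.
by rewrite mulr_sumr.
Qed.

Lemma has_laplacian_cst k x : has_laplacian (fun=> k) x 0.
Proof.
exists (fun=> (0, 0)) => [i|] /=; first exact: has_jet2_cst.
by rewrite big1.
Qed.

Lemma has_laplacianN f x l : has_laplacian f x l -> has_laplacian (fun y => - f y) x (- l).
Proof.
move=> fE; rewrite (_ : (fun y => _) = fun y => -1 * f y); last first.
  by apply/funext => y; rewrite mulN1r.
by apply: has_laplacian_eq (has_laplacianZ (-1) fE) _; rewrite mulN1r.
Qed.

Lemma has_laplacianD f g x l m : has_laplacian f x l -> has_laplacian g x m ->
  has_laplacian (fun y => f y + g y) x (l + m).
Proof.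
move=> fE /has_laplacianN gE; have := has_laplacianB fE gE.
rewrite opprK => /has_laplacian_eq; rewrite (_ : (fun y => _) = fun y => f y + g y).
  exact.
by apply/funext => y; rewrite opprK.
Qed.

Lemma has_laplacian_max f x l : has_laplacian f x l ->
  (\forall y \near x, f y <= f x) -> l <= 0.
Proof.
move=> [ab fE <-] fmax; apply: sumr_le0 => i _.
have [|_ //] := has_jet2_max (fE i).
rewrite scale0r addr0.
exact: cvg_line fmax.
Qed.

Lemma has_laplacian_dist2 x y :
  has_laplacian (fun z => dot (z - y) (z - y)) x (2 * N%:R).
Proof.
exists (fun i => (2 * (x - y) ord0 i, 2)) => [i|] /=; last first.
  by rewrite sumr_const card_ord mulr_natr.
rewrite (_ : (fun t => _) = fun t =>
    dot (x - y) (x - y) + (2 * (x - y) ord0 i * t + t * t)); last first.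
  apply/funext => t; rewrite /= (addrAC x); move: (x - y) => d.
  by rewrite !dotE (dotC (basis_vec R i)) !dot_basis basis_diag; ring.
apply: has_jet2_eq (has_jet2D (has_jet2_cst _)
  (has_jet2D (has_jet2Z _ (@has_jet2_id R)) (has_jet2M (@has_jet2_id R) (@has_jet2_id R)))) _ _;
  ring.
Qed.

Lemma has_laplacian_affine e k x :
  has_laplacian (fun z => dot z e - k) x 0.
Proof.
exists (fun i => (e ord0 i, 0)) => [i|] /=; last by rewrite big1.
rewrite (_ : (fun t => _) = fun t => (dot x e - k) + e ord0 i * t); last first.
  by apply/funext => t; rewrite dotDl dotZl (dotC (basis_vec R i)) dot_basis; ring.
by apply: has_jet2_eq (has_jet2D (has_jet2_cst _) (has_jet2Z _ (@has_jet2_id R))) _ _; ring.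
Qed.

Lemma has_laplacian_affine_sqr e k x :
  has_laplacian (fun z => (dot z e - k) ^+ 2) x (2 * dot e e).
Proof.
pose h i t := dot x e - k + e ord0 i * t.
have hE i : has_jet2 (h i) (e ord0 i) 0.
  by apply: has_jet2_eq (has_jet2D (has_jet2_cst _) (has_jet2Z _ (@has_jet2_id R))) _ _; ring.
exists (fun i => (2 * (dot x e - k) * e ord0 i, 2 * (e ord0 i * e ord0 i))) => [i|] /=;
  last by rewrite -mulr_sumr.
rewrite (_ : (fun t => _) = fun t => h i t * h i t); last first.
  apply/funext => t; rewrite dotDl dotZl (dotC (basis_vec R i)) dot_basis /h; ring.
by apply: has_jet2_eq (has_jet2M (hE i) (hE i)) _ _; rewrite /h; ring.
Qed.

Lemma has_laplacian_dist4 x y k :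
  has_laplacian (fun z => (k - dot (z - y) (z - y)) ^+ 2) x
    (8 * dot (x - y) (x - y) - 4 * N%:R * (k - dot (x - y) (x - y))).
Proof.
pose d := dot (x - y) (x - y).
pose h i t := k - d - (2 * (x - y) ord0 i * t + t * t).
have hE i : has_jet2 (h i) (- (2 * (x - y) ord0 i)) (- 2).
  apply: has_jet2_eq (has_jet2B (has_jet2_cst _)
    (has_jet2D (has_jet2Z _ (@has_jet2_id R)) (has_jet2M (@has_jet2_id R) (@has_jet2_id R)))) _ _;
  ring.
exists (fun i => (- (4 * (k - d) * (x - y) ord0 i),
    8 * ((x - y) ord0 i * (x - y) ord0 i) - 4 * (k - d))) => [i|] /=; last first.
  rewrite big_split/= -mulr_sumr -/(dot (x - y) (x - y)) sumr_const card_ord.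
  by rewrite -mulr_natr /d; ring.
rewrite (_ : (fun t => _) = fun t => h i t * h i t); last first.
  apply/funext => t; rewrite /= (addrAC x) /h /d; move: (x - y) => z.
  by rewrite !dotE (dotC (basis_vec R i)) !dot_basis basis_diag; ring.
by apply: has_jet2_eq (has_jet2M (hE i) (hE i)) _ _; rewrite /h; ring.
Qed.

Lemma directionalZ u x k v : directional u x (k *: v) = k * directional u x v.
Proof. by rewrite mulr_sumr; apply: eq_bigr => i _; rewrite mxE mulrA. Qed.

Lemma directional0 u x : directional u x 0 = 0.
Proof. by rewrite /directional big1// => i _; rewrite mxE mul0r. Qed.

Lemma hessianZ u x k v : hessian u x (k *: v) = k ^+ 2 * hessian u x v.
Proof.
rewrite mulr_sumr; apply: eq_bigr => i _.
by rewrite mxE directionalZ; ring.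
Qed.

Lemma directional_basis u x i : directional u x (basis_vec R i) = partial i u x.
Proof.
rewrite /directional (bigD1 i)//= big1 => [|j ji]; rewrite !mxE !eqxx/= ?mul1r ?addr0//.
by rewrite (negbTE ji) mul0r.
Qed.

(* With [k = 2] and [e] a unit vector the frame is the image of the standard
   basis under a reflection; with [k = (dot e e)^-1] it is its orthogonal
   projection onto the hyperplane normal to [e]. *)
Lemma hessian_frame u x e k :
  \sum_(i < N) hessian u x (basis_vec R i - (k * e ord0 i) *: e) =
  laplacian u x + (k ^+ 2 * dot e e - 2 * k) * hessian u x e.
Proof.
pose H (j l : 'I_N) := partial l (partial j u) x.
have hessE v : hessian u x v = \sum_(j < N) \sum_(l < N) v ord0 j * v ord0 l * H j l.
  apply: eq_bigr => j _; rewrite mulr_sumr; apply: eq_bigr => l _.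
  by rewrite mulrA.
have delta (j : 'I_N) (f : 'I_N -> R) : \sum_(i < N) (j == i)%:R * f i = f j.
  rewrite (bigD1 j)//= eqxx mul1r big1 ?addr0// => i ij.
  by rewrite eq_sym (negbTE ij) mul0r.
under eq_bigr do rewrite hessE.
rewrite exchange_big/= hessE /laplacian mulr_sumr -big_split/=; apply: eq_bigr => j _.
rewrite exchange_big/= mulr_sumr -[partial j _ x]/(H j j) -(delta j (H j)) -big_split/=; apply: eq_bigr => l _.
rewrite -mulr_suml; set S := (X in X * _ = _); rewrite -/(H j l).
rewrite (_ : S = (j == l)%:R + (k ^+ 2 * dot e e - 2 * k) * (e ord0 j * e ord0 l)).
  by ring.
rewrite {}/S.
transitivity (\sum_(i < N) ((j == i)%:R * (l == i)%:R
    - (j == i)%:R * (k * e ord0 i * e ord0 l)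
    - (l == i)%:R * (k * e ord0 i * e ord0 j)
    + k ^+ 2 * (e ord0 j * e ord0 l) * (e ord0 i * e ord0 i))).
  by apply: eq_bigr => i _; rewrite /basis_vec !mxE !eqxx/=; ring.
rewrite !big_split/= !sumrN !delta -mulr_sumr -/(dot e e) (eq_sym l j); ring.
Qed.

Lemma C2_on_line_jet A u x v : open A -> C2_on A u -> A x ->
  has_jet2 (fun t => u (x + t *: v)) (directional u x v) (hessian u x v).
Proof.
move=> oA uC2 Ax.
have xE : 1 *: x + 0 *: v = x by rewrite scale1r scale0r addr0.
have := @C2_on_jet2_comb R N A u (fun=> 1) (fun t => t) 0 0 1 0 x v oA uC2.
rewrite xE => /(_ Ax (has_jet2_cst _) (@has_jet2_id R)).
rewrite (_ : (fun t => _) = fun t => u (x + t *: v)); last first.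
  by apply/funext => t; rewrite scale1r.
by rewrite !scale0r !scale1r !add0r directional0 addr0.
Qed.

Lemma C2_on_radial_jet A u x (p : R -> R) (a b : R) :
  open A -> C2_on A u -> A x -> p 0 = 1 -> has_jet2 p a b ->
  has_jet2 (fun t => u (p t *: x)) (a * directional u x x)
    (a ^+ 2 * hessian u x x + b * directional u x x).
Proof.
move=> oA uC2 Ax p0 pE.
have xE : p 0 *: x + 0 *: x = x by rewrite p0 scale1r scale0r addr0.
have := @C2_on_jet2_comb R N A u p (fun=> 0) a b 0 0 x x oA uC2.
rewrite xE => /(_ Ax pE (has_jet2_cst _)).
rewrite (_ : (fun t => _) = fun t => u (p t *: x)); last first.
  by apply/funext => t; rewrite scale0r addr0.
by rewrite !scale0r !addr0 !directionalZ hessianZ.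
Qed.

Lemma C2_on_laplacian A u x : open A -> C2_on A u -> A x ->
  has_laplacian u x (laplacian u x).
Proof.
move=> oA uC2 Ax.
exists (fun i => (partial i u x, partial i (partial i u) x)) => // i /=.
have := C2_on_line_jet (basis_vec R i) oA uC2 Ax.
rewrite directional_basis /hessian (bigD1 i)//= big1 => [|j ji].
  by rewrite directional_basis !mxE !eqxx mul1r addr0.
by rewrite !mxE (negbTE ji) mul0r.
Qed.

Definition mirror e k x : 'rV[R]_N := x - (2 * (dot x e - k)) *: e.

Lemma C2_on_laplacian_reflect A u x e k : open A -> C2_on A u ->
  dot e e = 1 -> A (mirror e k x) ->
  has_laplacian (u \o mirror e k) x (laplacian u (mirror e k x)).
Proof.
move=> oA uC2 e1 Ax; pose w i := basis_vec R i - (2 * e ord0 i) *: e.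
exists (fun i => (directional u (mirror e k x) (w i), hessian u (mirror e k x) (w i))).
  move=> i /=.
  rewrite (_ : (fun t => _) = fun t => u (mirror e k x + t *: w i)).
    exact: C2_on_line_jet oA uC2 Ax.
  apply/funext => t; rewrite /= /mirror /w; congr u.
  apply/rowP => j; rewrite !mxE dotDl dotZl (dotC (basis_vec R i)) dot_basis; ring.
(* For [k = 2] and [dot e e = 1] the coefficient [k ^+ 2 * dot e e - 2 * k] vanishes. *)
by rewrite /w /= hessian_frame e1; ring.
Qed.

(** The test is applied along the great circle through [x] with velocity [p] and angular speed [c].
    Its acceleration [- c ^+ 2 *: x] produces the first-order term. *)
Lemma sphere_max_hessian A u x p k : open A -> C2_on A u -> A x -> x != 0 ->
  (forall y, dot y y = dot x x -> k * u y <= k * u x) -> dot x p = 0 ->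
  k * hessian u x p <= k * (dot p p / dot x x * directional u x x).
Proof.
move=> oA uC2 Ax x0 xmax xp.
have [->|p0] := eqVneq p 0.
  rewrite dot0l !mul0r mulr0 (_ : 0 = 0 *: p); last by rewrite scale0r.
  by rewrite hessianZ expr0n mul0r mulr0.
have xx := dot_gt0 x0; have pp := dot_gt0 p0.
pose c := Num.sqrt (dot p p / dot x x).
have c2 : c ^+ 2 = dot p p / dot x x by rewrite sqr_sqrtr// divr_ge0// ltW.
have c0 : 0 < c by rewrite sqrtr_gt0 divr_gt0.
have xE : cos (c * 0) *: x + (c^-1 * sin (c * 0)) *: p = x.
  by rewrite mulr0 cos0 sin0 mulr0 scale1r scale0r addr0.
have := @C2_on_jet2_comb R N A u _ _ _ _ _ _ x p oA uC2 _ (has_jet2_cos c)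
   (has_jet2Z c^-1 (has_jet2_sin c)).
rewrite xE => /(_ Ax)/(has_jet2Z k)/has_jet2_max[|_].
  apply: (@nearW _ (nbhs (0 : R))) => t /=; rewrite xE; apply: xmax.
  rewrite !dotE (dotC p x) xp.
  have -> : dot p p = c ^+ 2 * dot x x by rewrite c2 divfK// gt_eqF.
  have := cos2Dsin2 (c * t); set cc := cos _; set ss := sin _ => cs.
  rewrite -[RHS]mul1r -cs; field; exact: lt0r_neq0.
rewrite scale0r add0r mulVf ?gt_eqF// scale1r mulr0 scale0r addr0 directionalZ.
by rewrite c2 mulNr mulrBr subr_le0.
Qed.

(* With [k = 1], in polar coordinates: at a maximum over the sphere of radius [r],
   [laplacian u <= u_rr + (N - 1) / r * u_r], here multiplied by [r ^+ 2];
   [k = - 1] gives the reverse inequality at a minimum. *)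
Lemma sphere_max_laplacian A u x k : open A -> C2_on A u -> A x -> x != 0 ->
  (forall y, dot y y = dot x x -> k * u y <= k * u x) ->
  k * (dot x x * laplacian u x) <=
    k * (hessian u x x + (N%:R - 1) * directional u x x).
Proof.
move=> oA uC2 Ax x0 xmax; have xx := dot_gt0 x0.
have xx0 : dot x x != 0 by rewrite gt_eqF.
pose c := (dot x x)^-1; pose p i := basis_vec R i - (c * x ord0 i) *: x.
have pP i : k * hessian u x (p i) <=
    k * (dot (p i) (p i) / dot x x * directional u x x).
  apply: sphere_max_hessian oA uC2 Ax x0 xmax _.
  by rewrite /p /c !dotE dot_basis; field.
have := ler_sum (index_enum 'I_N) (fun i (_ : true) => pP i).
rewrite -!mulr_sumr hessian_frame -!mulr_suml.
(* The trace of the orthogonal projection onto the hyperplane normal to [x]. *)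
have -> : \sum_(i < N) dot (p i) (p i) = N%:R - 1.
  transitivity (\sum_(i < N) (1 - c * (x ord0 i * x ord0 i))).
    apply: eq_bigr => i _; rewrite /p /c !dotE (dotC (basis_vec R i) x) !dot_basis.
    by rewrite basis_diag; field.
  by rewrite big_split/= sumrN -mulr_sumr -/(dot x x) sumr_const card_ord mulVf.
rewrite -(ler_pM2l xx) => H.
have -> : k * (dot x x * laplacian u x) = dot x x *
    (k * (laplacian u x + (c ^+ 2 * dot x x - 2 * c) * hessian u x x))
    + k * hessian u x x.
  by rewrite /c; field.
rewrite [leRHS]mulrDr [leRHS]addrC lerD2r; apply: le_trans H _.
by rewrite le_eqVlt; apply/orP; left; apply/eqP; field.
Qed.

End laplacian_jets.

(** * Attained maxima, properties of the nonlinearity, blow-up *)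

Section attained_maxima.
Variable R : realType.

(** The sets [C] of interest are mostly open towards the sphere; there blow-up keeps [f] outside a
    compact [K] below a reference value taken in [K]. *)
Lemma max_outside_compact (T : topologicalType) (f : T -> R) (K C : set T) (x : T) :
  compact K -> K `<=` C -> K x -> (forall y, K y -> {for y, continuous f}) ->
  (forall y, C y -> ~ K y -> f y <= f x) ->
  exists2 z, K z & forall y, C y -> f y <= f z.
Proof.
move=> cK KC Kx fC fle.
have [||z /set_mem Kz zmax] := @compact_EVT_max T R f K _ cK; first by exists x.
  by apply: continuous_in_subspaceT => y /set_mem /fC.
exists z => // y Cy; have [Ky|nKy] := pselect (K y); first exact/zmax/mem_set.
by apply: le_trans (fle y Cy nKy) _; apply/zmax/mem_set.
Qed.

(** Compactness of the square of [[m, M]]: near the diagonal the local constant serves, and near a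
    pair of distinct points the difference quotient is bounded because its denominator stays away
    from zero. Letting [L] tend to infinity turns the local constants into a common one. *)
Lemma locally_lipschitz_itv (g : R -> R) (m M : R) : locally_lipschitz g ->
  exists2 L, 0 < L & forall s t, m <= s <= M -> m <= t <= M ->
    `|g s - g t| <= L * `|s - t|.
Proof.
move=> gL.
have lip x : exists d L : R, [/\ 0 < d, 0 < L &
    forall s t, `|x - s| < d -> `|x - t| < d -> `|g s - g t| <= L * `|s - t|].
  have [U /nbhs_ballP[d /= d0 dU] [L0 [L0r UL]]] := gL x.
  exists d, (Num.max L0 0 + 1); split => //.
    by apply: ltr_wpDl => //; rewrite le_max lexx orbT.
  move=> s t xs xt; apply: (UL _ _ (s, t)).
    by apply: (@le_lt_trans _ _ (Num.max L0 0)); rewrite ?le_max ?lexx ?ltrDl.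
  by split; apply: dU; rewrite -ball_normE.
pose I := [set` `[m, M]] : set R.
have cI : compact (I `*` I) by apply: compact_setX; exact: segment_compact.
have /compact_near_coveringP/(_ R +oo (fun L st =>
   `|g st.1 - g st.2| <= L * `|st.1 - st.2|)) := cI.
case=> [[s t] _|L0 [L0r L0P]]; last first.
  exists (Num.max L0 0 + 1); first by apply: ltr_wpDl => //; rewrite le_max lexx orbT.
  move=> s t sI tI; apply: (L0P _ _ (s, t)).
    by apply: (@le_lt_trans _ _ (Num.max L0 0)); rewrite ?le_max ?lexx ?ltrDl.
  by split; rewrite /I /= in_itv.
have [d [L1 [d0 L10 sP]]] := lip s; have [e [L2 [e0 L20 tP]]] := lip t.
have [st|st] := eqVneq s t.
  subst t; exists (ball (s, s) d, [set L | L1 < L]) => /=.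
    split; first exact: nbhsx_ballx.
    by exists L1; split => //; exact: num_real.
  move=> [[s' t'] L] /= [[ss tt] L1L].
  have {}ss : `|s - s'| < d by move: ss; rewrite -ball_normE.
  have {}tt : `|s - t'| < d by move: tt; rewrite -ball_normE.
  apply: le_trans (sP s' t' ss tt) _.
  by rewrite ler_wpM2r// ltW.
pose D := `|s - t|; have D0 : 0 < D by rewrite normr_gt0 subr_eq0.
pose r := Num.min (Num.min d e) (D / 4).
have r0 : 0 < r by rewrite !lt_min d0 e0 divr_gt0.
have [rd re rD] : [/\ r <= d, r <= e & r <= D / 4].
  by rewrite !ge_min !lexx !orbT.
pose B := `|g s - g t|.
(* On the [r]-neighbourhoods the values differ by at most [L1 * r + B + L2 * r], while the arguments
   stay at least [D / 2] apart because [r <= D / 4]. *)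
pose L3 := 2 * (L1 * r + B + L2 * r) / D.
have L30 : 0 <= L3.
  rewrite divr_ge0 ?(ltW D0)// mulr_ge0// !addr_ge0//.
  - by rewrite mulr_ge0// ltW.
  - exact: normr_ge0.
  - by rewrite mulr_ge0// ltW.
exists (ball (s, t) r, [set L | L3 < L]) => /=.
  split; first exact: nbhsx_ballx.
  by exists L3; split => //; exact: num_real.
move=> [[s' t'] L] /= [[ss tt] L3L].
have {}ss : `|s - s'| < r by move: ss; rewrite -ball_normE.
have {}tt : `|t - t'| < r by move: tt; rewrite -ball_normE.
have H1 : `|g s - g s'| <= L1 * r.
  apply: le_trans (sP s s' _ _) _; rewrite ?subrr ?normr0//.
    exact: lt_le_trans ss rd.
  by rewrite ler_wpM2l ?ltW.
have H2 : `|g t - g t'| <= L2 * r.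
  apply: le_trans (tP t t' _ _) _; rewrite ?subrr ?normr0//.
    exact: lt_le_trans tt re.
  by rewrite ler_wpM2l ?ltW.
have H3 : D / 2 <= `|s' - t'|.
  have : D <= `|s - s'| + `|s' - t'| + `|t - t'|.
    have -> : D = `|(s - s') + (s' - t') + (t' - t)| by congr `|_|; ring.
    by rewrite (le_trans (ler_normD _ _))// (distrC t t') lerD2r ler_normD.
  by lra.
have H4 : `|g s' - g t'| <= L1 * r + B + L2 * r.
  have -> : g s' - g t' = - (g s - g s') + (g s - g t) + (g t - g t') by ring.
  rewrite (le_trans (ler_normD _ _))// lerD// (le_trans (ler_normD _ _))//.
  by rewrite normrN lerD.
apply: le_trans H4 _.
have -> : L1 * r + B + L2 * r = L3 * (D / 2) by rewrite /L3; field; rewrite gt_eqF.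
by rewrite ler_pM// ?ltW// divr_gt0.
Qed.

Lemma convex_function_slope (g : R -> R) (a x y z : R) :
  convex_function (`[a, +oo[%classic : set R) g -> a <= x -> x < y -> y < z ->
  (g y - g x) * (z - y) <= (g z - g y) * (y - x).
Proof.
move=> gconv ax xy yz.
have xz : 0 < z - x by lra.
have t01 : (0 <= (z - y) / (z - x) <= 1).
  by rewrite divr_ge0 ?ler_pdivrMr// ?(ltW xz)//; lra.
case/andP: t01 => t0 t1.
pose t : {i01 R} := Itv01 t0 t1.
pose q := (z - y) / (z - x).
have H : g (q * x + (1 - q) * z) <= q * g x + (1 - q) * g z.
  by apply: (gconv t x z); rewrite inE/= in_itv/= andbT; lra.
have qy : q * x + (1 - q) * z = y by rewrite /q; field; rewrite gt_eqF.
rewrite qy in H.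
have qE : q * (z - x) = z - y by rewrite /q divfK// gt_eqF.
have : g y * (z - x) <= (q * g x + (1 - q) * g z) * (z - x) by rewrite ler_pM2r.
have -> : (q * g x + (1 - q) * g z) * (z - x) = (z - y) * g x + (y - x) * g z.
  have -> : (q * g x + (1 - q) * g z) * (z - x) =
     (q * (z - x)) * g x + ((z - x) - q * (z - x)) * g z by ring.
  by rewrite qE; ring.
by move=> {}H; rewrite -subr_ge0; move: H; rewrite -subr_ge0 => H; apply: le_trans H _;
  rewrite le_eqVlt; apply/orP; left; apply/eqP; ring.
Qed.

End attained_maxima.

Lemma blows_up_atP (R : realType) (N : nat) (rad : R) (u : 'rV[R]_N -> R) (M : R) :
  0 < rad -> blows_up_at rad u ->
  exists2 rho, 0 <= rho < rad & forall x, rho <= enorm x < rad -> M < u x.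
Proof.
move=> rad0 /(_ M)[e /= e0 eP].
exists (Num.max 0 (rad - e / 2)).
  by rewrite le_max lexx gt_max rad0/=; lra.
move=> x /andP[]; rewrite ge_max => /andP[x0 xe] xr.
by apply: (eP (enorm x)) => //=; rewrite ger0_norm; lra.
Qed.

Lemma closed_ge0 (R : realType) (T : topologicalType) (f : T -> R) :
  continuous f -> closed [set z | 0 <= f z].
Proof.
move=> fC; rewrite (_ : [set z | _] = f @^-1` [set s | 0 <= s])//.
by apply: closed_comp => [z _|]; [exact: fC|exact: closed_ge].
Qed.

Lemma compact_le_enorm (R : realType) (N : nat) (r : R) :
  compact [set x : 'rV[R]_N | enorm x <= r].
Proof.
apply: (@closed_le_compact _ _ r) => //.
rewrite (_ : [set x | _] = [set x : 'rV[R]_N | 0 <= r - enorm x]).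
  apply: closed_ge0 => x.
  by apply: (@cvgB _ _ _ (nbhs x) _ (cst r)); [exact: cvg_cst|exact: enorm_continuous].
by apply/seteqP; split => x /=; rewrite subr_ge0.
Qed.

(** Chord slopes of a convex function increase, so the slope of one rising chord bounds from below
    that of every chord to its right. *)
Lemma convex_growth (R : realType) (g : R -> R) (a : R) :
  convex_function (`[a, +oo[%classic : set R) g ->
  (exists s t, [/\ a <= s, s < t & g s < g t]) ->
  exists b c, [/\ a <= b, 0 < c &
    forall x y, b <= x -> x <= y -> c * (y - x) <= g y - g x].
Proof.
move=> gconv [s [t [as_ st gst]]]; exists t, ((g t - g s) / (t - s)).
have st0 : 0 < t - s by lra.
split; [lra|by rewrite divr_gt0//; lra|] => x y tx xy.
have [->|yx] := eqVneq y x; first by rewrite !subrr mulr0.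
have {}xy : x < y by rewrite lt_neqAle eq_sym yx.
rewrite mulrAC ler_pdivrMr//.
have [tx'|] := ltP t x; last first.
  move=> xt; have -> : x = t by lra.
  by apply: (convex_function_slope gconv) => //; lra.
have H1 := convex_function_slope gconv as_ st tx'.
have H2 : (g x - g t) * (y - x) <= (g y - g x) * (x - t).
  by apply: (convex_function_slope gconv) => //; lra.
have xt : 0 < x - t by lra.
rewrite -(ler_pM2l xt).
have := ler_wpM2r (ltW (_ : 0 < y - x)) H1; have := ler_wpM2r (ltW st0) H2.
have yx0 : 0 < y - x by lra.
move=> H3 /(_ yx0) H4; apply: (@le_trans _ _ ((g x - g t) * (y - x) * (t - s))).
  by apply: le_trans (le_trans H4 _); rewrite le_eqVlt; apply/orP; left; apply/eqP; ring.
by apply: le_trans H3 _; rewrite le_eqVlt; apply/orP; left; apply/eqP; ring.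
Qed.

Lemma blow_up_bounded_below (R : realType) (N : nat) (rad : R) (u : 'rV[R]_N -> R) :
  0 < rad -> (forall x, eball rad x -> {for x, continuous u}) -> blows_up_at rad u ->
  exists m, forall x, eball rad x -> m <= u x.
Proof.
move=> rad0 uC ublow.
have [rh /andP[rh0 rhR] rhP] := blows_up_atP (u 0) rad0 ublow.
have [||x|x Bx nKx|z _ zmin] := @max_outside_compact R _ (fun x => - u x)
    [set x | enorm x <= rh] (eball rad) 0 (@compact_le_enorm R N rh).
- by move=> x xr; exact: le_lt_trans rhR.
- by rewrite /= enormE dot0l sqrtr0.
- move=> xr; apply: (@cvgN _ _ _ (nbhs x)).
  by apply: uC; exact: le_lt_trans rhR.
- rewrite lerN2; apply/ltW/rhP; rewrite Bx andbT leNgt; apply/negP => /ltW.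
  exact: nKx.
by exists (u z) => x /zmin; rewrite lerN2.
Qed.

(** For [k = |C| + 1] the function [k * |x| ^+ 2 - u x] tends to minus infinity at the sphere, so it
    has an interior maximum. There [2 * N * k <= f z <= C], which is absurd. *)
Lemma large_solution_rhs_unbounded (R : realType) (N : nat) (rad : R)
    (u f : 'rV[R]_N -> R) (C : R) :
  (0 < N)%N -> 0 < rad -> C2_on (eball rad) u -> blows_up_at rad u ->
  (forall x, eball rad x -> laplacian u x = f x) ->
  ~ (forall x, eball rad x -> f x <= C).
Proof.
move=> N0 rad0 uC2 ublow uE fC; have oB := @eball_open R N rad.
pose k := `|C| + 1; have k0 : 0 < k by rewrite ltr_wpDl.
pose v x := k * dot (x - 0) (x - 0) - u x.
have [rho /andP[rho0 rhor] rhoP] := blows_up_atP (u 0 + k * rad ^+ 2) rad0 ublow.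
have uC x : eball rad x -> {for x, continuous u} by move=> /(uC2.1 x)[].
have [||x|y|z /= zrho zmax] := @max_outside_compact R _ v
    [set x | enorm x <= rho] (eball rad) 0 (@compact_le_enorm R N rho).
- by move=> x /=; rewrite /eball/=; lra.
- by rewrite /= enormE dot0l sqrtr0.
- move=> xr; have Bx : eball rad x by move: xr; rewrite /eball/=; lra.
  apply: (@cvgB _ _ _ (nbhs x)) (uC x Bx).
  apply: (@cvgM _ _ (nbhs x)); first exact: cvg_cst.
  have xx : y - 0 @[y --> x] --> x - 0 by apply: (@cvgB _ _ _ (nbhs x) _ id (cst 0)); [exact: cvg_id|exact: cvg_cst].
  exact: (cvg_dot _ xx xx).
- rewrite /eball/= => yr yrho; rewrite /v !subr0 dot0l mulr0 sub0r.
  have uy : u 0 + k * rad ^+ 2 < u y by apply: rhoP; rewrite yr andbT; lra.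
  have : k * dot y y <= k * rad ^+ 2.
    rewrite ler_pM2l// -enorm_sqr ler_sqr ?nnegrE ?enorm_ge0 ?(ltW rad0)//.
    exact: ltW.
  by lra.
have Bz : eball rad z by rewrite /eball/=; lra.
have zlap : has_laplacian v z (k * (2 * N%:R) - f z).
  rewrite -(uE _ Bz); apply: has_laplacianB; last exact: C2_on_laplacian oB uC2 Bz.
  exact/has_laplacianZ/has_laplacian_dist2.
have : k * (2 * N%:R) - f z <= 0.
  apply: has_laplacian_max zlap _.
  have : nbhs z (@eball R N rad) by exact: open_nbhs_nbhs.
  by apply: filterS => y; exact: zmax.
have := fC z Bz; have : (1 : R) <= N%:R by rewrite ler1n.
have := ler_norm C; rewrite /k => H1 H2 H3.
have : (`|C| + 1) * 2 <= (`|C| + 1) * (2 * N%:R) by rewrite ler_pM2l//; lra.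
have := normr_ge0 C; lra.
Qed.

(** * Comparison of the values of a large solution on two spheres *)

(** The algebra of the touching point in polar coordinates: [dx = r * u_r] and [hx = r ^+ 2 * u_rr]
    at the first point, likewise with [T] at the second; [A] and [- t * K] are the first two
    derivatives of [tau] at [r], and [n = N - 1]. The equation is stationarity. The last hypothesis
    says that the concavity of [tau] outweighs the mismatch [n * A / r - n * A ^+ 2 / T] of the
    curvature terms. *)
Lemma touching_inequality (R : realType) (r T A t K n gx gy hx hy dx dy : R) :
  0 < r -> 0 < T -> 0 <= A -> 0 <= dy ->
  r^-1 * dx - T^-1 * A * dy = 0 ->
  r^-1 ^+ 2 * hx - (T^-1 * A) ^+ 2 * hy + T^-1 * (t * K) * dy <= 0 ->
  r ^+ 2 * gx <= hx + n * dx -> hy + n * dy <= T ^+ 2 * gy ->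
  n * A * (T - r * A) <= t * K * (r * T) ->
  gx <= A ^+ 2 * gy.
Proof.
move=> r0 T0 A0 dy0 E1 E2 Hx Hy HK.
have rn : r != 0 by rewrite gt_eqF.
have Tn : T != 0 by rewrite gt_eqF.
pose Y := T^-1 * dy; pose P := r^-1 ^+ 2 * hx; pose Q := T^-1 ^+ 2 * hy.
have Y0 : 0 <= Y by rewrite mulr_ge0// invr_ge0 ltW.
have dyE : dy = T * Y by rewrite /Y; field.
have dxE : dx = r * (A * Y).
  have -> : A * Y = T^-1 * A * dy by rewrite /Y; ring.
  by move/eqP: E1; rewrite subr_eq0 => /eqP <-; field.
have hxE : hx = r ^+ 2 * P by rewrite /P; field.
have hyE : hy = T ^+ 2 * Q by rewrite /Q; field.
have F1 : gx <= P + r^-1 * (n * (A * Y)).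
  rewrite -(ler_pM2l (_ : 0 < r ^+ 2)) ?exprn_gt0//; apply: le_trans Hx _.
  by rewrite hxE dxE le_eqVlt; apply/orP; left; apply/eqP; field.
have F2 : Q + T^-1 * (n * Y) <= gy.
  rewrite -(ler_pM2l (_ : 0 < T ^+ 2)) ?exprn_gt0//; apply: le_trans Hy.
  by rewrite hyE dyE le_eqVlt; apply/orP; left; apply/eqP; field.
have F3 : P - A ^+ 2 * Q + t * K * Y <= 0.
  apply: le_trans E2; rewrite dyE /P hyE le_eqVlt; apply/orP; left; apply/eqP; field.
  by rewrite rn Tn.
have F4 : r^-1 * (n * A) - T^-1 * (n * A ^+ 2) <= t * K.
  rewrite -(ler_pM2r (_ : 0 < r * T)) ?mulr_gt0//; apply: le_trans HK.
  rewrite le_eqVlt; apply/orP; left; apply/eqP; field.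
  by rewrite rn Tn.
have F5 := ler_wpM2r Y0 F4.
have F6 := ler_wpM2l (sqr_ge0 A) F2.
have F7 : r^-1 * (n * (A * Y)) - A ^+ 2 * (T^-1 * (n * Y)) <= t * K * Y.
  by apply: le_trans F5; rewrite le_eqVlt; apply/orP; left; apply/eqP; ring.
rewrite mulrDr in F6; lra.
Qed.

(** Convexity is recorded through chords starting at [b], the form in which it combines with the
    growth bound to compare [g] with [u - b + g b / c]. *)
Record large_solution (R : realType) (N : nat) (rad : R) (g : R -> R)
    (u : 'rV[R]_N -> R) (b c : R) : Prop := LargeSolution {
  dim_gt0 : (0 < N)%N;
  radius_gt0 : 0 < rad;
  solution_C2 : C2_on (eball rad) u;
  solution_eq : forall x, eball rad x -> laplacian u x = g (u x);
  solution_blow_up : blows_up_at rad u;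
  rhs_slope_gt0 : 0 < c;
  rhs_gt0 : 0 < g b;
  rhs_growth : forall x y, b <= x -> x <= y -> c * (y - x) <= g y - g x;
  rhs_convex : forall x y, b < x -> x < y ->
    (g x - g b) * (y - x) <= (g y - g x) * (x - b);
  rhs_lipschitz : forall m M, exists2 L, 0 < L &
    forall s t, m <= s <= M -> m <= t <= M -> `|g s - g t| <= L * `|s - t| }.

Section large_solutions.
Variables (R : realType) (N : nat) (rad : R) (g : R -> R) (u : 'rV[R]_N -> R).
Variables (b c : R).
Hypothesis sol : large_solution rad g u b c.

Let oB := @eball_open R N rad.
Let uC2 := solution_C2 sol.
Let uE := solution_eq sol.

Lemma solution_continuous x : eball rad x -> {for x, continuous u}.
Proof. by move=> /(uC2.1 x)[]. Qed.

Lemma solution_laplacian x : eball rad x -> has_laplacian u x (g (u x)).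
Proof. by move=> Bx; rewrite -uE//; exact: C2_on_laplacian oB uC2 Bx. Qed.

Lemma large_ndecr x y : b <= x -> x <= y -> g x <= g y.
Proof.
move=> bx xy; rewrite -subr_ge0; apply: le_trans (rhs_growth sol bx xy).
by rewrite mulr_ge0 ?subr_ge0// ltW// (rhs_slope_gt0 sol).
Qed.

Lemma large_incr x y : b <= x -> x < y -> g x < g y.
Proof.
move=> bx xy; rewrite -subr_gt0; apply: lt_le_trans (rhs_growth sol bx (ltW xy)).
by rewrite mulr_gt0 ?subr_gt0// (rhs_slope_gt0 sol).
Qed.

Lemma large_gt0 x : b <= x -> 0 < g x.
Proof. by move=> bx; apply: lt_le_trans (rhs_gt0 sol) (large_ndecr _ bx). Qed.

Lemma solution_bounded r : r < rad ->
  exists M, forall x, enorm x <= r -> u x <= M.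
Proof.
move=> rr; have [r0|r0] := ltP r 0.
  by exists 0 => x xr; have := enorm_ge0 x; lra.
have [||x|y|z _ zmax] := @max_outside_compact R _ u
    [set x | enorm x <= r] [set x | enorm x <= r] 0 (@compact_le_enorm R N r) => //.
- by rewrite /= enormE dot0l sqrtr0.
- by move=> xr; apply: solution_continuous; move: xr; rewrite /eball/=; lra.
- by exists (u z) => x; exact: zmax.
Qed.

(** The hypotheses are the competitors available at a maximum of [u x - u y] with [|y| = tau |x|]:
    both points moving radially along the graph of [tau], [y0] moving outward, each point rotating
    on its sphere. The outward motion gives the sign of the radial derivative at [y0]. *)
Lemma touching_point x0 y0 (t K A : R) :
  let r := enorm x0 in let T := enorm y0 in
  0 < r < rad -> 0 < T < rad -> 0 <= A ->
  (\forall s \near (0 : R),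
     u ((1 + r^-1 * s) *: x0) - u ((1 + T^-1 * (A * s - t * K / 2 * (s * s))) *: y0)
       <= u x0 - u y0) ->
  (\forall s \near (0 : R)^'+, u y0 <= u (y0 + s *: y0)) ->
  (forall x, dot x x = dot x0 x0 -> u x <= u x0) ->
  (forall y, dot y y = dot y0 y0 -> u y0 <= u y) ->
  (N%:R - 1) * A * (T - r * A) <= t * K * (r * T) ->
  g (u x0) <= A ^+ 2 * g (u y0).
Proof.
move=> r T /andP[r0 rr] /andP[T0 Tr] A0 radial outward xmax ymin HK.
have Bx : eball rad x0 by exact: rr.
have By : eball rad y0 by exact: Tr.
have nz (z : 'rV[R]_N) : 0 < enorm z -> z != 0.
  by apply: contraTneq => ->; rewrite enormE dot0l sqrtr0 ltxx.
have xn := nz _ r0; have yn := nz _ T0.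
have id2 := has_jet2M (@has_jet2_id R) (@has_jet2_id R).
have px := has_jet2D (has_jet2_cst 1) (has_jet2Z r^-1 (@has_jet2_id R)).
have py := has_jet2D (has_jet2_cst 1) (has_jet2Z T^-1
  (has_jet2B (has_jet2Z A (@has_jet2_id R)) (has_jet2Z (t * K / 2) id2))).
have [] := has_jet2_max (has_jet2B (C2_on_radial_jet oB uC2 Bx _ px)
    (C2_on_radial_jet oB uC2 By _ py)).
- by rewrite mulr0 addr0.
- by rewrite !mulr0 subrr mulr0 addr0.
- apply: filterS radial => s; rewrite !mulr0 subrr mulr0 !addr0.
  by rewrite !scale1r.
move=> E1 E2.
have jout := has_jet2N (C2_on_line_jet y0 oB uC2 By).
have dy0 : 0 <= directional u y0 y0.
  rewrite -oppr_le0; apply: has_jet2_right_le jout _.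
  by apply: filterS outward => s; rewrite scale0r addr0 lerN2.
have Hx := @sphere_max_laplacian R N _ u x0 1 oB uC2 Bx xn.
have Hy := @sphere_max_laplacian R N _ u y0 (-1) oB uC2 By yn.
apply: (@touching_inequality R r T A t K (N%:R - 1) _ _ (hessian u x0 x0)
  (hessian u y0 y0) (directional u x0 x0) (directional u y0 y0)) => //.
- by rewrite -[RHS]E1; ring.
- apply: le_trans E2; rewrite le_eqVlt; apply/orP; left; apply/eqP; field.
  by rewrite !gt_eqF.
- rewrite enorm_sqr -uE//; have := Hx; rewrite !mul1r; apply.
  by move=> y /xmax; rewrite !mul1r.
- rewrite enorm_sqr -uE//; have := Hy; rewrite !mulN1r lerN2; apply.
  by move=> y /ymin; rewrite !mulN1r lerN2.
Qed.

End large_solutions.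

Lemma continuous_enorm_fst (R : realType) (N : nat) :
  continuous (fun z : 'rV[R]_N * 'rV[R]_N => enorm z.1).
Proof.
move=> z; apply: (@cvg_enorm _ _ _ (nbhs z) fst); exact: cvg_fst.
Qed.

Lemma continuous_enorm_snd (R : realType) (N : nat) :
  continuous (fun z : 'rV[R]_N * 'rV[R]_N => enorm z.2).
Proof.
move=> z; apply: (@cvg_enorm _ _ _ (nbhs z) snd); exact: cvg_snd.
Qed.

Section outward_shift.
Variables (R : realType) (rad r0 K t : R).
Hypotheses (r0_ge : rad / 2 <= r0) (r0_lt : r0 < rad) (width : rad - r0 <= 1 / 2).
Hypotheses (K_ge0 : 0 <= K) (K_width : K * (rad - r0) <= 1).
Hypotheses (t_gt0 : 0 < t) (t_le : t <= 1 / 4).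

(** This is the map [tau]. Its slope [outward_slope] lies in [[0, 1]] on the layer and its second
    derivative is the constant [- t * K]. Being quadratic, it has an exact expansion, which gives
    the radius of [y] in the radial variation. *)
Definition outward_shift (r : R) : R :=
  r + t * (1 - (r - r0) - K * (r - r0) ^+ 2 / 2).

Definition outward_slope (r : R) : R := 1 - t * (1 + K * (r - r0)).

Lemma shift_bounds r : r0 <= r -> r <= rad ->
  r + t / 4 <= outward_shift r /\ outward_shift r <= r + t.
Proof.
move=> r1 r2; rewrite /outward_shift.
have s0 : 0 <= r - r0 by rewrite subr_ge0.
have s1 : r - r0 <= 1 / 2 by apply: le_trans width; rewrite lerD2r.
have Ks1 : K * (r - r0) <= 1 by apply: le_trans K_width; rewrite ler_wpM2l// lerD2r.
have Ks0 := mulr_ge0 K_ge0 s0; move: (r - r0) s0 s1 Ks0 Ks1 => s s0 s1 Ks0 Ks1.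
have H1 : (K * s) * s <= 1 * s by rewrite ler_wpM2r.
have H2 : 0 <= (K * s) * s by rewrite mulr_ge0.
have H3 : 1 / 4 <= 1 - s - K * s ^+ 2 / 2.
  by rewrite (_ : K * s ^+ 2 = (K * s) * s); [lra|ring].
have H4 : 1 - s - K * s ^+ 2 / 2 <= 1.
  by rewrite (_ : K * s ^+ 2 = (K * s) * s); [lra|ring].
split; rewrite lerD2l.
  by apply: le_trans (ler_wpM2l (ltW t_gt0) H3); rewrite mul1r.
by apply: le_trans (ler_wpM2l (ltW t_gt0) H4) _; rewrite mulr1.
Qed.

Lemma shift_continuous : continuous outward_shift.
Proof.
move=> r; have id_r : r' @[r' --> r] --> r by exact: cvg_id.
have cst_r k : (fun=> k) @ r --> (k : R) by exact: cvg_cst.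
have rr : r' - r0 @[r' --> r] --> r - r0 by exact: (cvgB id_r (cst_r r0)).
exact: (cvgD id_r (cvgM (cst_r t) (cvgB (cvgB (cst_r 1) rr)
  (cvgM (cvgM (cst_r K) (cvgM rr rr)) (cst_r 2^-1))))).
Qed.

Lemma shiftD r s : outward_shift (r + s) =
  outward_shift r + (outward_slope r * s - t * K / 2 * (s * s)).
Proof. by rewrite /outward_shift /outward_slope; field. Qed.

Lemma slope_itv r : r0 <= r -> r <= rad ->
  0 <= outward_slope r /\ outward_slope r <= 1.
Proof.
move=> r1 r2; rewrite /outward_slope.
have Ks0 : 0 <= K * (r - r0) by rewrite mulr_ge0// subr_ge0.
have Ks1 : K * (r - r0) <= 1 by apply: le_trans K_width; rewrite ler_wpM2l// lerD2r.
have H1 : 0 <= t * (1 + K * (r - r0)) by apply: mulr_ge0; [exact: ltW|rewrite addr_ge0].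
have H2 : t * (1 + K * (r - r0)) <= 1 / 4 * 2.
  by apply: ler_pM; move: t_gt0 t_le Ks0 Ks1; lra.
by move: H1 H2; lra.
Qed.

(** The left side is at most [n * t * (1 + 2 * rad)], the right side at least [t * K * rad ^+ 2 / 4]
    since both radii are at least [rad / 2]. The factor [t] cancels, so [K] can be chosen before
    [t]. *)
Lemma shift_curvature r n : 0 <= n -> 4 * n * (1 + 2 * rad) <= K * rad ^+ 2 ->
  r0 <= r -> r <= rad ->
  n * outward_slope r * (outward_shift r - r * outward_slope r) <=
    t * K * (r * outward_shift r).
Proof.
move=> n0 nK r1 r2; have [A0 A1] := slope_itv r1 r2.
have [T1 T2] := shift_bounds r1 r2.
have Ks1 : K * (r - r0) <= 1 by apply: le_trans K_width; rewrite ler_wpM2l// lerD2r.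
have Ks0 : 0 <= K * (r - r0) by rewrite mulr_ge0// subr_ge0.
have H1 : outward_shift r - r * outward_slope r <= t * (1 + 2 * rad).
  have -> : outward_shift r - r * outward_slope r =
      t * (1 - (r - r0) - K * (r - r0) ^+ 2 / 2 + r * (1 + K * (r - r0))).
    by rewrite /outward_shift /outward_slope; ring.
  rewrite ler_wpM2l ?(ltW t_gt0)//.
  have : r * (1 + K * (r - r0)) <= rad * 2.
    by apply: ler_pM; move: r0_ge r0_lt r1 r2 Ks0 Ks1; lra.
  have : 0 <= K * (r - r0) ^+ 2 by rewrite mulr_ge0// sqr_ge0.
  by move: r1; lra.
apply: (@le_trans _ _ (n * 1 * (t * (1 + 2 * rad)))).
  apply: (@le_trans _ _ (n * outward_slope r * (t * (1 + 2 * rad)))).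
    by rewrite ler_wpM2l// mulr_ge0.
  apply: ler_wpM2r; last by rewrite ler_wpM2l.
  by rewrite mulr_ge0 ?(ltW t_gt0)//; move: r0_ge r0_lt; lra.
apply: (@le_trans _ _ (t * K * (rad / 2 * (rad / 2)))).
  have -> : n * 1 * (t * (1 + 2 * rad)) = t / 4 * (4 * n * (1 + 2 * rad)) by field.
  have -> : t * K * (rad / 2 * (rad / 2)) = t / 4 * (K * rad ^+ 2) by field.
  by rewrite ler_wpM2l// divr_ge0// ltW.
rewrite ler_wpM2l ?mulr_ge0 ?(ltW t_gt0)//.
by apply: ler_pM; move: r0_ge r0_lt r1 t_gt0 T1; lra.
Qed.

Section maximum.
Variables (N : nat) (g : R -> R) (u : 'rV[R]_N -> R) (b c : R).
Hypothesis sol : large_solution rad g u b c.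
Hypothesis K_curvature : 4 * (N%:R - 1) * (1 + 2 * rad) <= K * rad ^+ 2.

Definition shifted_pairs : set ('rV[R]_N * 'rV[R]_N) :=
  [set z | [/\ r0 <= enorm z.1, enorm z.1 <= rad,
               outward_shift (enorm z.1) <= enorm z.2 & enorm z.2 < rad]].

(* Both radial derivatives are nonnegative at an interior maximum, and the
   concavity of [outward_shift] absorbs the curvature terms. *)
Lemma shifted_pairs_no_max x0 y0 : shifted_pairs (x0, y0) -> r0 < enorm x0 ->
  b < u y0 -> u y0 < u x0 ->
  ~ (forall x y, shifted_pairs (x, y) -> u x - u y <= u x0 - u y0).
Proof.
move=> [/= _ rR rT TR] rr0 uy0 ux0 zmax.
have [tau1 tau2] := shift_bounds (ltW rr0) rR.
have R0 := radius_gt0 sol.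
have rpos : 0 < enorm x0 by move: r0_ge rr0 R0; lra.
have Tpos : 0 < enorm y0 by move: rpos tau1 t_gt0 rT; lra.
have {}rR : enorm x0 < rad by move: rT tau1 t_gt0 TR; lra.
have Bx : eball rad x0 by [].
have gxy : g (u y0) < g (u x0) by exact: large_incr sol _ _ (ltW uy0) ux0.
have gy : 0 < g (u y0) by exact: large_gt0 sol _ (ltW uy0).
have enC := @enorm_continuous R N x0.
have near_r0 : \forall x \near x0, r0 < enorm x by exact: (cvgr_gt _ enC).
have near_rad : \forall x \near x0, enorm x < rad by exact: (cvgr_lt _ enC).
(* Under strict inequality [x0] moves freely with [y0] kept, so [u] has a local maximum at [x0],
   against [g (u x0) > 0]. *)
have [rTlt|Tr] := ltP (outward_shift (enorm x0)) (enorm y0).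
  have : g (u x0) <= 0.
    apply: has_laplacian_max (solution_laplacian sol Bx) _.
    have near_tau : \forall x \near x0, outward_shift (enorm x) < enorm y0.
      have : outward_shift (enorm x) @[x --> x0] --> outward_shift (enorm x0).
        exact: (cvg_comp _ _ enC (@shift_continuous _)).
      by move=> /cvgr_lt; apply.
    near=> x; rewrite -(lerD2r (- u y0)).
    by apply: zmax; split => //=; apply/ltW; near: x.
  by rewrite leNgt (lt_trans gy gxy).
have {Tr rT} TE : enorm y0 = outward_shift (enorm x0) by apply/eqP; rewrite eq_le Tr.
have [A0 A1] := slope_itv (ltW rr0) (ltW rR).
(* As the slope is at most 1, this bound contradicts [g (u y0) < g (u x0)]. *)
have : g (u x0) <= outward_slope (enorm x0) ^+ 2 * g (u y0); last first.
  rewrite leNgt (le_lt_trans _ gxy)// -[leRHS]mul1r.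
  by rewrite ler_wpM2r ?(ltW gy)// expr_le1.
have cvg_rs : enorm x0 + s @[s --> (0 : R)] --> enorm x0.
  rewrite -[X in _ --> X]addr0; apply: (@cvgD _ _ _ (nbhs (0 : R)) _ (cst (enorm x0))).
    exact: cvg_cst.
  exact: cvg_id.
apply: (touching_point sol (t := t) (K := K)) => //.
- by rewrite rpos.
- by rewrite Tpos.
- have near1 : \forall s \near (0 : R), r0 < enorm x0 + s by exact: (cvgr_gt _ cvg_rs).
  have near2 : \forall s \near (0 : R), enorm x0 + s < rad by exact: (cvgr_lt _ cvg_rs).
  have near3 : \forall s \near (0 : R), outward_shift (enorm x0 + s) < rad.
    have : outward_shift (enorm x0 + s) @[s --> (0 : R)] --> outward_shift (enorm x0).
      exact: (cvg_comp _ _ cvg_rs (@shift_continuous _)).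
    by move=> /cvgr_lt; apply; rewrite -TE.
  near=> s.
  have H1 : r0 < enorm x0 + s by near: s.
  have H2 : enorm x0 + s < rad by near: s.
  have H3 : outward_shift (enorm x0 + s) < rad by near: s.
  have [H4 _] := shift_bounds (ltW H1) (ltW H2).
  have E1 : enorm ((1 + (enorm x0)^-1 * s) *: x0) = enorm x0 + s.
    rewrite enormZ ger0_norm.
      by field; rewrite gt_eqF.
    have -> : 1 + (enorm x0)^-1 * s = (enorm x0)^-1 * (enorm x0 + s).
      by field; rewrite gt_eqF.
    by rewrite mulr_ge0 ?invr_ge0 ?enorm_ge0//; move: H1 R0 r0_ge; lra.
  have := shiftD (enorm x0) s; rewrite -TE; set w := outward_slope _ * s - _ => wE.
  have E2 : enorm ((1 + (enorm y0)^-1 * w) *: y0) = outward_shift (enorm x0 + s).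
    have -> : 1 + (enorm y0)^-1 * w = (enorm y0)^-1 * (enorm y0 + w).
      by rewrite [RHS]mulrDr mulVf ?gt_eqF.
    rewrite enormZ ger0_norm -wE; first by rewrite mulrAC mulVf ?gt_eqF// mul1r.
    rewrite mulr_ge0 ?invr_ge0 ?enorm_ge0//; move: H1 R0 r0_ge H4 t_gt0; lra.
  by apply: zmax; split; rewrite /= ?E1 ?E2// ltW.
- have near1 : \forall s \near (0 : R)^'+, (1 + s) * enorm y0 < rad.
    have : (1 + s) * enorm y0 @[s --> (0 : R)^'+] --> (1 + 0) * enorm y0.
      apply: cvg_at_right_filter.
      have id_0 : s @[s --> (0 : R)] --> (0 : R) by exact: cvg_id.
      have cst_0 k : (fun=> k) @ (0 : R) --> (k : R) by exact: cvg_cst.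
      exact: (cvgM (cvgD (cst_0 1) id_0) (cst_0 (enorm y0))).
    by rewrite addr0 mul1r => /cvgr_lt; apply.
  near=> s.
  have s_gt0 : 0 < s by near: s; exact: nbhs_right_gt.
  have H1 : (1 + s) * enorm y0 < rad by near: s.
  have E1 : enorm (y0 + s *: y0) = (1 + s) * enorm y0.
    by rewrite -[X in X + _]scale1r -scalerDl enormZ gtr0_norm// addr_gt0.
  rewrite -lerN2 -(lerD2l (u x0)).
  apply: zmax; split; rewrite /= ?E1 ?H1 ?(ltW rr0) ?(ltW rR)//.
  by rewrite -TE ler_peMl ?(ltW Tpos)// lerDl ltW.
- move=> x xx; have xE : enorm x = enorm x0 by rewrite !enormE xx.
  rewrite -(lerD2r (- u y0)).
  by apply: zmax; split; rewrite /= ?xE -?TE// ltW.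
- move=> y yy; have yE : enorm y = enorm y0 by rewrite !enormE yy.
  rewrite -lerN2 -(lerD2l (u x0)).
  by apply: zmax; split; rewrite /= ?yE -?TE// ltW.
- rewrite TE; apply: shift_curvature; rewrite ?(ltW rr0) ?(ltW rR)//.
  by rewrite subr_ge0 ler1n (dim_gt0 sol).
Unshelve. all: by end_near. Qed.

(** A larger difference would force an attained maximum, and this can only have [|x| = r0], where
    [u x <= b + C] and [u y > b]. Hence the same [C] serves for all [t]. *)
Lemma shifted_pairs_bound C x y : 0 <= C ->
  (forall z, r0 <= enorm z < rad -> b < u z) ->
  (forall z, enorm z <= r0 -> u z <= b + C) ->
  shifted_pairs (x, y) -> u x <= u y + C.
Proof.
move=> C0 ub uC xyD; rewrite leNgt; apply/negP => big.
pose F (z : 'rV[R]_N * 'rV[R]_N) := u z.1 - u z.2.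
have Dx z : shifted_pairs z -> enorm z.1 <= rad - t / 4.
  move=> [z1 z2 z3 z4]; have [] := shift_bounds z1 z2.
  by move: z3 z4; lra.
have tR : rad - t / 4 < rad by move: t_gt0; lra.
have [U UP] := solution_bounded sol tR.
(* Once [|y|] exceeds [rh], the difference falls below its value at the given pair. *)
have [rh /andP[rh0 rhR] rhP] :=
  blows_up_atP (U - F (x, y)) (radius_gt0 sol) (solution_blow_up sol).
pose rho := Num.max rh (enorm y).
have [rho1 rho2] : rh <= rho /\ enorm y <= rho by rewrite !le_max !lexx orbT.
have rhoR : rho < rad by rewrite gt_max rhR; case: xyD.
pose Kc := [set z : 'rV[R]_N * 'rV[R]_N |
  [/\ 0 <= enorm z.1 - r0, 0 <= rad - enorm z.1,
      0 <= enorm z.2 - outward_shift (enorm z.1) & 0 <= rho - enorm z.2]].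
have KcE z : Kc z <-> [/\ r0 <= enorm z.1, enorm z.1 <= rad,
    outward_shift (enorm z.1) <= enorm z.2 & enorm z.2 <= rho].
  by rewrite /Kc/= !subr_ge0.
have KcD : Kc `<=` shifted_pairs.
  by move=> z /KcE[z1 z2 z3 z4]; split => //; exact: le_lt_trans rhoR.
have cKc : compact Kc.
  apply: subclosed_compact
    (compact_setX (@compact_le_enorm R N rad) (@compact_le_enorm R N rad)) _.
    rewrite (_ : Kc = [set z | 0 <= enorm z.1 - r0] `&` [set z | 0 <= rad - enorm z.1]
        `&` [set z | 0 <= enorm z.2 - outward_shift (enorm z.1)]
        `&` [set z | 0 <= rho - enorm z.2]).
      have e1 := @continuous_enorm_fst R N; have e2 := @continuous_enorm_snd R N.
      have cst_z k (z : 'rV[R]_N * 'rV[R]_N) : (fun=> k) @ z --> (k : R) by exact: cvg_cst.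
      apply: closedI; first apply: closedI; first apply: closedI.
      - by apply: closed_ge0 => z; exact: (cvgB (e1 z) (cst_z r0 z)).
      - by apply: closed_ge0 => z; exact: (cvgB (cst_z rad z) (e1 z)).
      - apply: closed_ge0 => z.
        exact: (cvgB (e2 z) (cvg_comp _ _ (e1 z) (@shift_continuous _))).
      - by apply: closed_ge0 => z; exact: (cvgB (cst_z rho z) (e2 z)).
    by apply/seteqP; split=> z; [move=> []|move=> [[[]]]].
  move=> z /KcE[z1 z2 z3 z4]; split => //=.
  exact: le_trans z4 (ltW rhoR).
have [|z Kz|z Dz nKz|z0 /KcD Dz0 zmax] :=
    @max_outside_compact R _ F Kc shifted_pairs (x, y) cKc KcD.
- by case: xyD => /= ? ? ? ?; apply/KcE; split.
- have [z1 z2 z3 z4] := KcD _ Kz; apply: (@cvgB _ _ _ (nbhs z)).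
    apply: (cvg_comp fst u); first exact: cvg_fst.
    apply: (solution_continuous sol); exact: le_lt_trans (Dx _ (KcD _ Kz)) tR.
  apply: (cvg_comp snd u); first exact: cvg_snd.
  exact: (solution_continuous sol).
- rewrite lerBlDr; apply: (@le_trans _ _ U); first exact/UP/Dx.
  rewrite -lerBlDl; apply/ltW/rhP; case: (Dz) => z1 z2 z3 z4; rewrite z4 andbT.
  rewrite leNgt; apply/negP => zrh; apply: nKz; apply/KcE; split => //.
  exact: le_trans (ltW zrh) rho1.
have := zmax _ xyD; case: z0 Dz0 zmax => x0 y0 Dz0 zmax; rewrite /F/= => Fz0.
have [z1 z2 z3 z4] := Dz0; rewrite /= in z1 z2 z3 z4.
have uy0 : b < u y0.
  apply: ub; rewrite z4 andbT; apply: (le_trans z1 (le_trans _ z3)).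
  by have [+ _] := shift_bounds z1 z2; move: t_gt0; lra.
have ux0 : u y0 + C < u x0 by move: Fz0 big; lra.
apply: (shifted_pairs_no_max Dz0) => [|//||x' y' /zmax//].
  rewrite lt_neqAle z1 andbT; apply/eqP => rE.
  by have := uC x0; rewrite -rE lexx => /(_ isT); move: uy0 ux0; lra.
by move: ux0 C0; lra.
Qed.

End maximum.

End outward_shift.

Lemma two_point_bound (R : realType) (N : nat) (rad : R) (g : R -> R)
    (u : 'rV[R]_N -> R) (b c : R) (sol : large_solution rad g u b c) :
  exists r0 C, [/\ 0 < r0, r0 < rad,
    forall x, r0 <= enorm x < rad -> b < u x &
    forall x y, enorm x < enorm y -> r0 <= enorm y < rad -> u x <= u y + C].
Proof.
have R0 := radius_gt0 sol; have N1 : (1 : R) <= N%:R by rewrite ler1n (dim_gt0 sol).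
have [rb /andP[rb0 rbR] rbP] := blows_up_atP b R0 (solution_blow_up sol).
(* The least [K] meeting the curvature condition. The three bounds on [d] give [rad - r0 <= 1 / 2],
   [rad / 2 <= r0] and [K * (rad - r0) <= 1]; [K + 1] is invertible even when [K = 0]. *)
pose K : R := 4 * (N%:R - 1) * (1 + 2 * rad) / rad ^+ 2.
have K0 : 0 <= K.
  apply: divr_ge0; last by rewrite exprn_ge0// ltW.
  by apply: mulr_ge0; [apply: mulr_ge0|]; lra.
pose d := Num.min (Num.min (1 / 2) (rad / 2)) (K + 1)^-1.
have d0 : 0 < d by rewrite !lt_min !divr_gt0//= invr_gt0; lra.
have [d1 d2 d3] : [/\ d <= 1 / 2, d <= rad / 2 & d <= (K + 1)^-1].
  by rewrite !ge_min !lexx !orbT.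
pose r0 := Num.max rb (rad - d).
have [r0b r0d] : rb <= r0 /\ rad - d <= r0 by rewrite !le_max !lexx orbT.
have r0R : r0 < rad by rewrite gt_max rbR/=; lra.
have r00 : rad / 2 <= r0 by lra.
have width : rad - r0 <= 1 / 2 by lra.
have Kwidth : K * (rad - r0) <= 1.
  apply: (@le_trans _ _ (K * (K + 1)^-1)); first by rewrite ler_wpM2l//; lra.
  by rewrite ler_pdivrMr; lra.
have r0P x : r0 <= enorm x < rad -> b < u x.
  by move=> /andP[H ?]; apply: rbP; apply/andP; split => //; exact: le_trans H.
have [Cs CsP] := solution_bounded sol r0R.
pose C := Num.max 0 (Cs - b).
have [C0 C1] : 0 <= C /\ Cs - b <= C by rewrite !le_max !lexx orbT.
exists r0, C; split => //; first lra.
move=> x y xy /andP[ry yR].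
have [xr|/ltW rx] := leP (enorm x) r0.
  have := CsP _ xr; have : b < u y by apply: r0P; rewrite ry.
  by move: C1; clear; lra.
(* [outward_shift] raises radii by at most [t], so the given pair is admissible. *)
pose t := Num.min (1 / 4) (enorm y - enorm x).
have t0 : 0 < t by rewrite lt_min subr_gt0 xy andbT; lra.
have [t1 t2] : t <= 1 / 4 /\ t <= enorm y - enorm x.
  by rewrite !ge_min !lexx !orbT.
have xR := lt_trans xy yR.
apply: (shifted_pairs_bound r00 r0R width K0 Kwidth t0 t1 sol) => //.
- by rewrite /K divfK// gt_eqF// exprn_gt0.
- by move=> z /CsP; move: C1; clear; lra.
split => //=; first exact: ltW.
have [_] := shift_bounds width K0 Kwidth t0 rx (ltW xR).
by move: t2; lra.
Qed.

(** * Strong minimum principle *)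

Section strong_minimum_principle.
Variables (R : realType) (N : nat).
Implicit Types (w : 'rV[R]_N -> R) (x y p q : 'rV[R]_N).

Lemma dist2_continuous y : continuous (fun x => dot (x - y) (x - y)).
Proof.
move=> x; have xy : z - y @[z --> x] --> x - y.
  by apply: (@cvgB _ _ _ (nbhs x) _ id (cst y)); [exact: cvg_id|exact: cvg_cst].
exact: (cvg_dot _ xy xy).
Qed.

Lemma compact_shell y (r1 r2 : R) :
  compact [set x | r1 <= dot (x - y) (x - y) <= r2].
Proof.
apply: (@closed_le_compact _ _ (enorm y + Num.sqrt r2)).
  rewrite (_ : [set x | _] = [set x | 0 <= dot (x - y) (x - y) - r1] `&`
      [set x | 0 <= r2 - dot (x - y) (x - y)]); last first.
    apply/seteqP; split=> x /=; rewrite !subr_ge0; first by move=> /andP[].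
    by move=> [-> ->].
  have cst_x k x : (fun=> k) @ nbhs x --> (k : R) by exact: cvg_cst.
  apply: closedI; apply: closed_ge0 => x.
    exact: (cvgB (@dist2_continuous y x) (cst_x r1 x)).
  exact: (cvgB (cst_x r2 x) (@dist2_continuous y x)).
move=> x /= /andP[_ xr]; rewrite -{1}(subrK y x) addrC.
apply: le_trans (enormD _ _) _; rewrite lerD2l enormE.
by rewrite ler_wsqrtr.
Qed.

(** Meant for minus the gap, with [C] a Lipschitz constant of [g] on a bounded range of values of
    [u]. *)
Definition supersolution_at w (C : R) x : Prop :=
  [/\ 0 <= w x, {for x, continuous w} & exists2 l, has_laplacian w x l & l <= C * w x].

(* The barrier [(rho ^+ 2 - |x - y| ^+ 2) ^+ 2] is a strict subsolution on the shell
   [theta * rho < |x - y| < rho] when [theta] is close to [1]. *)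
Lemma ball_positivity w y (rho C theta : R) :
  0 < rho -> 0 < theta < 1 -> 0 <= C ->
  0 < 8 * theta ^+ 2 - 4 * N%:R * (1 - theta ^+ 2)
      - C * (1 - theta ^+ 2) ^+ 2 * rho ^+ 2 ->
  (forall x, dot (x - y) (x - y) <= rho ^+ 2 -> supersolution_at w C x) ->
  (forall x, dot (x - y) (x - y) <= (theta * rho) ^+ 2 -> 0 < w x) ->
  forall x, dot (x - y) (x - y) < rho ^+ 2 -> 0 < w x.
Proof.
move=> rho0 /andP[th0 th1] C0 cond sup_w inner xs xsD.
have [|out] := leP (dot (xs - y) (xs - y)) ((theta * rho) ^+ 2); first exact: inner.
have rr : 0 < rho ^+ 2 by rewrite exprn_gt0.
have th2 : 0 < theta ^+ 2 < 1 by rewrite exprn_gt0//= expr_lt1// ltW.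
case/andP: th2 => th2 th21.
have tr : (theta * rho) ^+ 2 < rho ^+ 2 by rewrite exprMn gtr_pMl.
have [||x /andP[_ xi]|x xin nxin|z /andP[_ zin] zmin] := @max_outside_compact R _ (fun x => - w x)
   [set x | 0 <= dot (x - y) (x - y) <= (theta * rho) ^+ 2]
   [set x | 0 <= dot (x - y) (x - y) <= (theta * rho) ^+ 2] y (@compact_shell _ _ _) => //.
- by rewrite /= subrr dot0l lexx/= sqr_ge0.
- apply: (@cvgN _ _ _ (nbhs x)).
  by case: (sup_w x) => //; exact: le_trans xi (ltW tr).
pose eta := w z; have eta0 : 0 < eta by exact: inner.
(* Scaled so that on [|x - y| = theta * rho] the barrier equals [eta], the minimum of [w] over the
   inner ball. *)
pose beta := eta / (rho ^+ 2 - (theta * rho) ^+ 2) ^+ 2.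
have gap : 0 < rho ^+ 2 - (theta * rho) ^+ 2 by rewrite subr_gt0.
have beta0 : 0 < beta by rewrite divr_gt0// exprn_gt0.
pose f x := beta * (rho ^+ 2 - dot (x - y) (x - y)) ^+ 2 - w x.
suff : f xs <= 0.
  rewrite subr_le0; apply: lt_le_trans.
  by rewrite mulr_gt0// exprn_gt0// subr_gt0.
rewrite leNgt; apply/negP => fxs.
pose K := [set x | (theta * rho) ^+ 2 <= dot (x - y) (x - y) <= rho ^+ 2].
have [||x /andP[_ x2]|x xin nxin|x0 /andP[in0 out0] fmax] := @max_outside_compact R _ f K K xs
    (@compact_shell _ _ _) => //.
- by apply/andP; split; exact: ltW.
- apply: (@cvgB _ _ _ (nbhs x)); last by case: (sup_w x x2).
  have cst_x k : (fun=> k) @ nbhs x --> (k : R) by exact: cvg_cst.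
  have dx : rho ^+ 2 - dot (z - y) (z - y) @[z --> x] -->
      rho ^+ 2 - dot (x - y) (x - y).
    exact: (cvgB (cst_x (rho ^+ 2)) (@dist2_continuous y x)).
  exact: (cvgM (cst_x beta) (cvgM dx dx)).
have fx0 : 0 < f x0.
  by apply: lt_le_trans fxs _; apply: fmax; apply/andP; split; exact: ltW.
have [w0 _ [l lw lC]] := sup_w x0 out0.
have {}in0 : (theta * rho) ^+ 2 < dot (x0 - y) (x0 - y).
  rewrite lt_neqAle in0 andbT; apply/eqP => E; move: fx0.
  rewrite /f -E /beta divfK ?expf_neq0 ?gt_eqF// subr_gt0 => wE.
  have := zmin x0; rewrite /= -E lexx sqr_ge0 => /(_ isT); rewrite lerN2 leNgt.
  by rewrite wE.
have {}out0 : dot (x0 - y) (x0 - y) < rho ^+ 2.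
  rewrite lt_neqAle out0 andbT; apply/eqP => E; move: fx0.
  by rewrite /f E subrr expr0n mulr0 sub0r oppr_gt0 ltNge w0.
have flap := has_laplacianB (has_laplacianZ beta (has_laplacian_dist4 x0 y (rho ^+ 2))) lw.
have : beta * (8 * dot (x0 - y) (x0 - y)
    - 4 * N%:R * (rho ^+ 2 - dot (x0 - y) (x0 - y))) - l <= 0.
  apply: has_laplacian_max flap _.
  have near1 := cvgr_gt _ (@dist2_continuous y x0) _ in0.
  have near2 := cvgr_lt _ (@dist2_continuous y x0) _ out0.
  near=> x; apply: fmax; apply/andP; split; apply: ltW; [near: x; exact: near1|].
  by near: x; exact: near2.
apply/negP; rewrite -ltNge.
move: in0 out0 fx0; rewrite /f; set D := dot (x0 - y) (x0 - y) => in0 out0 fx0.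
(* At [x0] the barrier exceeds [w], so it also bounds the zeroth-order term [C * w x0]. *)
have lbd : l <= beta * (C * (rho ^+ 2 - D) ^+ 2).
  apply: le_trans lC _; rewrite mulrCA ler_wpM2l//.
  by move: fx0; rewrite subr_gt0 => /ltW.
apply: (@lt_le_trans _ _ (beta * (8 * D - 4 * N%:R * (rho ^+ 2 - D)
    - C * (rho ^+ 2 - D) ^+ 2))); last by rewrite mulrBr lerD2l lerN2.
rewrite mulr_gt0//; apply: (@lt_le_trans _ _ (rho ^+ 2 * (8 * theta ^+ 2
    - 4 * N%:R * (1 - theta ^+ 2) - C * (1 - theta ^+ 2) ^+ 2 * rho ^+ 2))).
  exact: mulr_gt0.
have s0 : 0 <= rho ^+ 2 - D by rewrite subr_ge0 ltW.
have s1 : rho ^+ 2 - D <= rho ^+ 2 * (1 - theta ^+ 2).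
  by rewrite mulrBr mulr1 lerD2l lerN2 mulrC -exprMn ltW.
have H1 : C * (rho ^+ 2 - D) ^+ 2 <= C * (rho ^+ 2 * (1 - theta ^+ 2)) ^+ 2.
  by rewrite ler_wpM2l// ler_sqr ?nnegrE// (le_trans s0).
have H2 : 4 * N%:R * (rho ^+ 2 - D) <= 4 * N%:R * (rho ^+ 2 * (1 - theta ^+ 2)).
  by rewrite ler_wpM2l// mulr_ge0.
have H3 : rho ^+ 2 * theta ^+ 2 <= D by rewrite mulrC -exprMn ltW.
have -> : rho ^+ 2 * (8 * theta ^+ 2 - 4 * N%:R * (1 - theta ^+ 2)
    - C * (1 - theta ^+ 2) ^+ 2 * rho ^+ 2) = 8 * (rho ^+ 2 * theta ^+ 2)
    - 4 * N%:R * (rho ^+ 2 * (1 - theta ^+ 2)) - C * (rho ^+ 2 * (1 - theta ^+ 2)) ^+ 2.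
  by ring.
by apply: lerB => //; apply: lerB => //; rewrite ler_pM2l.
Unshelve. all: by end_near. Qed.

(* Positivity propagates along the segment through finitely many overlapping balls. *)
Lemma strong_minimum_principle w p q (rho C : R) :
  (0 < N)%N -> 0 < rho <= 1 -> 0 <= C ->
  (forall (t : R) x, 0 <= t <= 1 -> enorm (x - (p + t *: (q - p))) <= rho ->
    supersolution_at w C x) ->
  (forall x, enorm (x - p) <= rho -> 0 < w x) -> 0 < w q.
Proof.
move=> N0 /andP[rho0 rho1] C0 sup_w wp.
have N1 : (1 : R) <= N%:R by rewrite ler1n.
(* Small enough for [N * sg <= 1 / 4], [C * sg <= 1] and [sg <= 1 / 8]. With [th = 1 - sg] one has
   [1 - th ^+ 2 <= 2 * sg], and the barrier condition follows as [rho <= 1]. *)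
pose sg : R := (4 * N%:R + 4 + C)^-1.
have den : 0 < 4 * N%:R + 4 + C by lra.
have sg0 : 0 < sg by rewrite invr_gt0.
have sgN : (4 * N%:R + 4 + C) * sg = 1 by rewrite mulfV// gt_eqF.
have sgN' : N%:R * sg <= 1 / 4.
  have : 0 <= C * sg by rewrite mulr_ge0// ltW.
  by move: sgN sg0; lra.
have sgC : C * sg <= 1 by have : 0 <= N%:R * sg by [rewrite mulr_ge0// ltW]; move: sgN sg0; lra.
have sg8 : sg <= 1 / 8.
  have : 1 * sg <= N%:R * sg by rewrite ler_wpM2r// ltW.
  have : 0 <= C * sg by rewrite mulr_ge0// ltW.
  by move: sgN; lra.
pose th := 1 - sg.
have th01 : 0 < th < 1 by rewrite /th; apply/andP; split; move: sg0 sg8; lra.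
have cond : 0 < 8 * th ^+ 2 - 4 * N%:R * (1 - th ^+ 2)
      - C * (1 - th ^+ 2) ^+ 2 * rho ^+ 2.
  have thE : 1 - th ^+ 2 = 2 * sg - sg ^+ 2 by rewrite /th; ring.
  have u0 : 0 <= 1 - th ^+ 2.
    by rewrite subr_ge0 expr_le1//; case/andP: th01 => /ltW ? /ltW.
  have u1 : 1 - th ^+ 2 <= 2 * sg by rewrite thE gerBl sqr_ge0.
  have H1 : N%:R * (1 - th ^+ 2) <= 1 / 2.
    by apply: (@le_trans _ _ (N%:R * (2 * sg))); [rewrite ler_wpM2l|move: sgN'; lra].
  have H2 : C * (1 - th ^+ 2) <= 2.
    by apply: (@le_trans _ _ (C * (2 * sg))); [rewrite ler_wpM2l|move: sgC; lra].
  have H3 : C * (1 - th ^+ 2) ^+ 2 * rho ^+ 2 <= 2 * (2 * sg) * 1.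
    apply: ler_pM; rewrite ?exprn_ge0 ?mulr_ge0 ?exprn_ge0 ?(ltW rho0)//.
      have := ler_pM (mulr_ge0 C0 u0) u0 H2 u1; rewrite -mulrA -expr2. exact.
    by rewrite expr_le1// ltW.
  by move: H1 H3 u1 sg8; lra.
(* Consecutive centres are then less than [sg * rho = rho - th * rho] apart, so each inner ball lies
   in the open [rho]-ball about the previous centre. *)
have [M MP] : exists M : nat, enorm (q - p) < M%:R * (sg * rho).
  exists (Num.bound (enorm (q - p) / (sg * rho))).
  rewrite -ltr_pdivrMr ?mulr_gt0// archi_boundP//.
  by rewrite divr_ge0 ?enorm_ge0// ltW// mulr_gt0.
have M0 : 0 < M%:R :> R.
  by rewrite -(pmulr_lgt0 _ (mulr_gt0 sg0 rho0)) (le_lt_trans (enorm_ge0 _) MP).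
pose y n := p + (n%:R / M%:R) *: (q - p).
have leE x n r : 0 <= r -> (dot (x - y n) (x - y n) <= r ^+ 2) = (enorm (x - y n) <= r).
  by move=> r0; rewrite enorm_ler_sqr.
have thr : 0 <= th * rho by rewrite mulr_ge0 ?(ltW rho0)//; case/andP: th01 => /ltW.
have thr1 : th * rho <= rho by rewrite ler_piMl ?(ltW rho0)//; case/andP: th01 => _ /ltW.
have chain n : (n <= M)%N -> forall x, dot (x - y n) (x - y n) <= (th * rho) ^+ 2 -> 0 < w x.
  elim: n => [_ x|n IH nM x].
    rewrite leE// /y mul0r scale0r addr0 => xp; apply: wp; exact: le_trans thr1.
  rewrite leE// => xy.
  apply: (ball_positivity rho0 th01 C0 cond _ (IH (ltnW nM))) => [z|].
    rewrite leE ?(ltW rho0)// => zy; apply: (sup_w (n%:R / M%:R)) => //.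
    by rewrite divr_ge0//= ler_pdivrMr// mul1r ler_nat ltnW.
  rewrite -enorm_ltr_sqr ?(ltW rho0)//.
  have -> : x - y n = (x - y n.+1) + M%:R^-1 *: (q - p).
    rewrite /y -natr1 mulrDl mul1r scalerDl; apply/rowP => i; rewrite !mxE; ring.
  apply: le_lt_trans (enormD _ _) _.
  have -> : rho = th * rho + sg * rho by rewrite /th; ring.
  rewrite ler_ltD// enormZ ger0_norm ?invr_ge0 ?(ltW M0)//.
  by rewrite ltr_pdivrMl.
apply: (chain M) => //; rewrite /y mulfV ?gt_eqF// scale1r.
by rewrite (addrC p) subrK subrr dot0l sqr_ge0.
Qed.

End strong_minimum_principle.

(** * Moving planes *)

Section reflections.
Variables (R : realType) (N : nat) (e : 'rV[R]_N).
Hypothesis e1 : dot e e = 1.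
Implicit Types (x : 'rV[R]_N) (k : R).

Lemma dot_reflect k x : dot (mirror e k x) (mirror e k x) =
  dot x x - 4 * k * (dot x e - k).
Proof. by rewrite /mirror !dotE (dotC e x) e1; ring. Qed.

Lemma enorm_reflect_lt k x : 0 < k -> k < dot x e -> enorm (mirror e k x) < enorm x.
Proof.
move=> k0 kx; rewrite enorm_ltr_sqr ?enorm_ge0// enorm_sqr dot_reflect gtrBl.
by rewrite !mulr_gt0// subr_gt0.
Qed.

Lemma reflect_fixed k x : dot x e = k -> mirror e k x = x.
Proof. by move=> xk; rewrite /mirror xk subrr mulr0 scale0r subr0. Qed.

Lemma cvg_reflect (T : Type) (F : set_system T) (kk : T -> R) (xx : T -> 'rV[R]_N) k x :
  Filter F -> kk @ F --> k -> xx @ F --> x ->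
  mirror e (kk t) (xx t) @[t --> F] --> mirror e k x.
Proof.
move=> FF kE xE.
have cst_F (c : R) : (fun=> c) @ F --> c by exact: cvg_cst.
have cst_e : (fun=> e) @ F --> e by exact: cvg_cst.
have xe : dot (xx t) e @[t --> F] --> dot x e by exact: (cvg_dot _ xE cst_e).
have s2 : 2 * (dot (xx t) e - kk t) @[t --> F] --> 2 * (dot x e - k).
  exact: (cvgM (cst_F 2) (cvgB xe kE)).
by apply: cvgB xE _; exact: (cvgZr_tmp s2).
Qed.

End reflections.

Section caps.
Variables (R : realType) (N : nat) (rad : R) (g : R -> R) (u : 'rV[R]_N -> R).
Variables (b c : R).
Hypothesis sol : large_solution rad g u b c.
Variable e : 'rV[R]_N.
Hypothesis e1 : dot e e = 1.
Implicit Types (x : 'rV[R]_N) (k : R).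

Let oB := @eball_open R N rad.

(** For [k > 0], reflection moves points beyond the hyperplane closer to the centre, so the goal is
    a negative gap there. *)
Definition gap k x : R := u (mirror e k x) - u x.

Definition cap k : set 'rV[R]_N := [set x | enorm x < rad /\ k < dot x e].

Lemma enorm_reflect_le k x : 0 < k -> k <= dot x e -> enorm (mirror e k x) <= enorm x.
Proof.
move=> k0; rewrite le_eqVlt => /orP[/eqP kx|kx]; first by rewrite reflect_fixed.
exact: ltW (enorm_reflect_lt e1 k0 kx).
Qed.

(** Convergence is joint in the hyperplane and the point: the position [k] varies in the one-sided
    limit and in the compactness argument that move the hyperplane. *)
Lemma gap_cvg (T : Type) (F : set_system T) (kk : T -> R) (xx : T -> 'rV[R]_N) k x :
  Filter F -> kk @ F --> k -> xx @ F --> x -> 0 < k -> eball rad x -> k <= dot x e ->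
  gap (kk t) (xx t) @[t --> F] --> gap k x.
Proof.
move=> FF kE xE k0 Bx kx.
have Bt : eball rad (mirror e k x) by exact: le_lt_trans (enorm_reflect_le k0 kx) Bx.
have c1 : u (mirror e (kk t) (xx t)) @[t --> F] --> u (mirror e k x).
  apply: (cvg_comp (fun t => mirror e (kk t) (xx t)) u).
    exact: (cvg_reflect FF kE xE).
  exact: solution_continuous sol _ Bt.
have c2 : u (xx t) @[t --> F] --> u x.
  by apply: (cvg_comp xx u xE); exact: solution_continuous sol _ Bx.
exact: (cvgB c1 c2).
Qed.

Lemma gap_continuous k x : 0 < k -> eball rad x -> k <= dot x e ->
  {for x, continuous (gap k)}.
Proof.
move=> k0 Bx kx; apply: (@gap_cvg _ (nbhs x) (fun=> k) id) => //; first exact: cvg_cst.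
Qed.

Lemma gap_laplacian k x : 0 < k -> eball rad x -> k <= dot x e ->
  has_laplacian (gap k) x (g (u (mirror e k x)) - g (u x)).
Proof.
move=> k0 Bx kx.
have Bt : eball rad (mirror e k x) by exact: le_lt_trans (enorm_reflect_le k0 kx) Bx.
apply: has_laplacianB (solution_laplacian sol Bx).
by rewrite -(solution_eq sol Bt); exact: C2_on_laplacian_reflect oB (solution_C2 sol) e1 Bt.
Qed.

Lemma gap_fixed k x : dot x e = k -> gap k x = 0.
Proof. by move=> xk; rewrite /gap reflect_fixed// subrr. Qed.

Lemma cap_open k : open (cap k).
Proof.
rewrite (_ : cap k = @eball R N rad `&` (fun x => dot x e) @^-1` [set s | k < s]).
  apply: openI => //; apply: open_comp => [x _|]; last exact: open_gt.
  exact: dot_continuousr.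
by apply/seteqP; split => x [].
Qed.

Lemma compact_closed_cap r1 r2 k :
  compact [set x | [/\ r1 <= enorm x, enorm x <= r2 & k <= dot x e]].
Proof.
apply: (@closed_le_compact _ _ r2) => [|x []//].
rewrite (_ : [set x | _] = [set x | 0 <= enorm x - r1] `&` [set x | 0 <= r2 - enorm x]
    `&` [set x | 0 <= dot x e - k]).
  have cst_x l x : (fun=> l) @ nbhs x --> (l : R) by exact: cvg_cst.
  apply: closedI; first apply: closedI; apply: closed_ge0 => x.
  - exact: (cvgB (@enorm_continuous R N x) (cst_x r1 x)).
  - exact: (cvgB (cst_x r2 x) (@enorm_continuous R N x)).
  - exact: (cvgB (@dot_continuousr R N e x) (cst_x k x)).
apply/seteqP; split => x /=; rewrite !subr_ge0; first by move=> [].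
by move=> [[]].
Qed.

(** * Control of the gap near the sphere *)

Section boundary_layer.
Variables (r0 C : R).
Hypotheses (r0_gt0 : 0 < r0) (r0_lt : r0 < rad).
Hypothesis u_large : forall x, r0 <= enorm x < rad -> b < u x.
Hypothesis u_mono : forall x y, enorm x < enorm y -> r0 <= enorm y < rad ->
  u x <= u y + C.

Let radius_gap : 0 < rad ^+ 2 - r0 ^+ 2.
Proof.
by rewrite subr_gt0 ltr_pXn2r// nnegrE ltW// (lt_trans r0_gt0).
Qed.

(** Chosen so that [corner_slope * (rad ^+ 2 - |x| ^+ 2)], which vanishes on the sphere, equals
    [|C| + 1] for [|x| = r0] and so exceeds the gap there. *)
Definition corner_slope : R := (`|C| + 1) / (rad ^+ 2 - r0 ^+ 2).

Lemma corner_slope_gt0 : 0 < corner_slope.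
Proof. by rewrite divr_gt0// ltr_wpDl. Qed.

(** Put [G = g (s + z) - g s]. Convexity from [b] gives [(g s - g b) * z <= G * (s - b)], and growth
    gives [g b * z <= G * (g b / c)]. Their sum is [g s * z <= G * V] with [V = s - b + g b / c],
    which explains the shift [g b / c]. *)
Lemma convex_increment s z eps : b < s -> 0 < z ->
  eps * (s - b + g b / c) < z -> eps * g s < g (s + z) - g s.
Proof.
move=> bs z0; set V := s - b + g b / c => epsz.
have c0 := rhs_slope_gt0 sol; have gb0 := rhs_gt0 sol.
have V0 : 0 < V by rewrite addr_gt0 ?subr_gt0 ?divr_gt0.
have gs := large_gt0 sol (ltW bs).
have sz : s < s + z by rewrite ltrDl.
have H1 := rhs_convex sol bs sz; have H2 := rhs_growth sol (ltW bs) (ltW sz).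
rewrite addrAC subrr add0r in H1 H2.
set G := g (s + z) - g s in H1 H2 *.
have H3 : g s * z <= G * V.
  have H4 : z * g b <= G * (g b / c).
    rewrite mulrA ler_pdivlMr//.
    by have := ler_wpM2r (ltW gb0) H2; rewrite mulrAC mulrC mulrA; apply: le_trans;
      rewrite le_eqVlt; apply/orP; left; apply/eqP; ring.
  by rewrite /V mulrDr; move: H1 H4; rewrite mulrBl; lra.
rewrite -(ltr_pM2r V0); apply: lt_le_trans H3.
by rewrite mulrAC mulrC ltr_pM2l.
Qed.

(* Convexity makes [u - b + g b / c] a supersolution of the linear equation
   satisfied by the gap.  As it blows up at the boundary while the gap is bounded,
   every small multiple of it, added to the superharmonic function
   [corner_slope * (rad ^+ 2 - |x| ^+ 2)], dominates the gap. *)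
Lemma corner_bound k x : 0 < k -> cap k x -> r0 <= enorm x ->
  gap k x <= corner_slope * (rad ^+ 2 - dot x x).
Proof.
move=> k0 [xR kx] xr0; have c0 := rhs_slope_gt0 sol; have gb0 := rhs_gt0 sol.
have K0 := corner_slope_gt0.
pose V y := u y - b + g b / c; pose Y (y : 'rV[R]_N) := corner_slope * (rad ^+ 2 - dot y y).
have V0 y : r0 <= enorm y < rad -> 0 < V y.
  by move=> /u_large uy; rewrite addr_gt0 ?divr_gt0// subr_gt0.
have Y0 y : enorm y < rad -> 0 <= Y y.
  move=> yR; rewrite mulr_ge0 ?(ltW K0)// subr_ge0 -enorm_sqr ler_sqr ?nnegrE ?enorm_ge0//.
    exact: ltW.
  exact: ltW (radius_gt0 sol).
(* Since [eps] is arbitrary the term that blows up disappears; the instance used makes it half of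
   the supposed excess. *)
suff eps_bound eps : 0 < eps -> gap k x <= eps * V x + Y x.
  rewrite -subr_le0 leNgt; apply/negP => d0.
  have Vx : 0 < V x by apply: V0; rewrite xr0.
  have := eps_bound ((gap k x - Y x) / (2 * V x)) (divr_gt0 d0 (mulr_gt0 (ltr0Sn _ _) Vx)).
  have -> : (gap k x - Y x) / (2 * V x) * V x = (gap k x - Y x) / 2.
    by field; rewrite gt_eqF.
  by move: d0; rewrite -/(Y x); lra.
move=> eps0; rewrite leNgt; apply/negP => big.
pose f y := gap k y - (eps * V y + Y y).
pose S := [set y : 'rV[R]_N | [/\ r0 <= enorm y, enorm y < rad & k <= dot y e]].
have fixed_le y : S y -> dot y e = k -> f y <= 0.
  move=> [y1 y2 _] yk; rewrite /f gap_fixed// sub0r oppr_le0 addr_ge0 ?Y0//.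
  by rewrite mulr_ge0 ?(ltW eps0)// ltW// V0// y1.
have gapC y : S y -> k < dot y e -> gap k y <= C.
  move=> [y1 y2 _] yk; rewrite lerBlDr addrC; apply: u_mono; last by rewrite y1.
  exact: (enorm_reflect_lt e1 k0 yk).
(* Beyond [rh] the term [eps * V] alone exceeds [|C|], hence the gap. *)
have [rh /andP[rh0 rhR] rhP] := blows_up_atP (b + `|C| / eps) (radius_gt0 sol) (solution_blow_up sol).
pose rho := Num.max rh (enorm x).
have [rho1 rho2] : rh <= rho /\ enorm x <= rho by rewrite !le_max !lexx orbT.
have rhoR : rho < rad by rewrite gt_max rhR.
pose K := [set y : 'rV[R]_N | [/\ r0 <= enorm y, enorm y <= rho & k <= dot y e]].
have fx : 0 < f x by rewrite subr_gt0.
have [y [y1 y2 y3]||y Ky|y Sy nKy|x0 [z1 z2 z3] fmax] := @max_outside_compact R _ f K S x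
    (@compact_closed_cap r0 rho k).
- by split => //; exact: le_lt_trans rhoR.
- by split => //; exact: ltW.
- have [y1 y2 y3] := Ky; have yR : enorm y < rad by exact: le_lt_trans rhoR.
  have cst_y l : (fun=> l) @ nbhs y --> (l : R) by exact: cvg_cst.
  have uy := solution_continuous sol yR.
  have yy : (fun y => y) @ nbhs y --> y by exact: cvg_id.
  exact: (cvgB (gap_continuous k0 yR y3) (cvgD
    (cvgM (cst_y eps) (cvgD (cvgB uy (cst_y b)) (cst_y (g b / c))))
    (cvgM (cst_y corner_slope) (cvgB (cst_y (rad ^+ 2)) (cvg_dot _ yy yy))))).
- apply: le_trans _ (ltW fx); have [y1 y2] := Sy.
  rewrite le_eqVlt => /orP[/eqP yk|yk]; first exact: fixed_le.
  rewrite subr_le0; apply: le_trans (gapC _ Sy yk) _.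
  rewrite -[C]addr0; apply: lerD; last exact: Y0.
  apply: le_trans (ler_norm C) _; rewrite mulrC -ler_pdivrMr//.
  have : b + `|C| / eps < u y.
    apply: rhP; rewrite y2 andbT leNgt; apply/negP => yrh; apply: nKy; split => //.
      exact: le_trans (ltW yrh) rho1.
    exact: ltW.
  have : 0 < g b / c by rewrite divr_gt0.
  by rewrite /V; lra.
have x0R : enorm x0 < rad by exact: le_lt_trans rhoR.
have fx0 : 0 < f x0 by apply: lt_le_trans fx _; apply: fmax; split => //; exact: ltW.
have {}z3 : k < dot x0 e.
  rewrite lt_neqAle z3 andbT; apply/eqP => E.
  by have := fixed_le x0 (And3 z1 x0R z3) (esym E); rewrite leNgt fx0.
have {}z1 : r0 < enorm x0.
  rewrite lt_neqAle z1 andbT; apply/eqP => E.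
  have : f x0 <= 0; last by rewrite leNgt fx0.
  rewrite subr_le0; apply: le_trans (gapC _ (And3 z1 x0R (ltW z3)) z3) _.
  rewrite -[C]add0r; apply: lerD.
    by rewrite mulr_ge0 ?(ltW eps0)// ltW// V0// z1.
  rewrite /Y -enorm_sqr -E /corner_slope divfK ?gt_eqF//.
  by apply: le_trans (ler_norm C) _; rewrite lerDl.
have flap : has_laplacian f x0 (g (u (mirror e k x0)) - g (u x0)
    - (eps * (g (u x0) - 0 + 0) + corner_slope * (0 - 2 * N%:R))).
  apply: has_laplacianB; first exact: gap_laplacian k0 x0R (ltW z3).
  apply: has_laplacianD.
    apply: has_laplacianZ; apply: has_laplacianD (has_laplacian_cst _ _).
    exact: has_laplacianB (solution_laplacian sol x0R) (has_laplacian_cst _ _).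
  apply: has_laplacianZ; apply: has_laplacianB; first exact: has_laplacian_cst.
  rewrite (_ : (fun y => dot y y) = fun y => dot (y - 0) (y - 0)).
    exact: has_laplacian_dist2.
  by apply/funext => y; rewrite subr0.
have : g (u (mirror e k x0)) - g (u x0)
    - (eps * (g (u x0) - 0 + 0) + corner_slope * (0 - 2 * N%:R)) <= 0.
  apply: has_laplacian_max flap _.
  have n1 := cvgr_gt _ (@enorm_continuous R N x0) _ z1.
  have n2 := cvgr_lt _ (@enorm_continuous R N x0) _ x0R.
  have n3 := cvgr_gt _ (@dot_continuousr R N e x0) _ z3.
  near=> y; apply: fmax; split; [| |]; first by apply: ltW; near: y; exact: n1.
    by near: y; exact: n2.
  by apply: ltW; near: y; exact: n3.
apply/negP; rewrite -ltNge.
have YY := Y0 _ x0R; have ub0 : b < u x0 by apply: u_large; rewrite x0R ltW.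
have VV : 0 < eps * V x0 by rewrite mulr_gt0// V0// x0R ltW.
(* With the gap above [eps * V x0], convexity makes the increment of [g] exceed [eps * g (u x0)], so
   the Laplacian of [f] at its maximum would be positive. *)
have gap0 : eps * V x0 < gap k x0.
  by move: fx0 YY; rewrite /f; lra.
have := convex_increment ub0 (lt_trans VV gap0) gap0.
rewrite (_ : u x0 + gap k x0 = u (mirror e k x0)); last first.
  by rewrite /gap addrC subrK.
have : 0 < corner_slope * (2 * N%:R).
  by rewrite mulr_gt0// mulr_gt0// ltr0n (dim_gt0 sol).
by lra.
Unshelve. all: by end_near. Qed.

End boundary_layer.
End caps.

Section moving_planes.
Variables (R : realType) (N : nat) (rad : R) (g : R -> R) (u : 'rV[R]_N -> R).
Variables (b c : R).
Hypothesis sol : large_solution rad g u b c.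
Implicit Types (x e : 'rV[R]_N) (k : R).

(** A Lipschitz constant on the bounded interval from [m] to [b] suffices: beyond [b] the function
    increases, so raising [t] further only helps. Thus [t] may be arbitrarily large, as the values
    of [u] near the sphere require. *)
Lemma rhs_one_sided_lipschitz m : exists2 L, 0 < L &
  forall s t, m <= s -> s <= t -> g s - g t <= L * (t - s).
Proof.
have [L L0 LP] := rhs_lipschitz sol m b.
exists L => // s t ms st.
have [bs|sb] := leP b s.
  apply: (@le_trans _ _ 0); first by rewrite subr_le0; exact: (large_ndecr sol).
  by rewrite mulr_ge0 ?subr_ge0// ltW.
have lip t' : s <= t' -> t' <= b -> g s - g t' <= L * (t' - s).
  move=> st' tb; apply: le_trans (ler_norm _) _.
  apply: le_trans (LP s t' _ _) _; rewrite ?ms ?(ltW sb)//.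
    by rewrite tb (le_trans ms).
  by rewrite distrC ger0_norm// subr_ge0.
have [tb|bt] := leP t b; first exact: lip.
have := lip b (ltW sb) (lexx b); have := large_ndecr sol (lexx b) (ltW bt).
have : L * (b - s) <= L * (t - s) by rewrite ler_pM2l// lerD2r ltW.
lra.
Qed.

Section fixed_direction.
Variables (e : 'rV[R]_N) (m L r0 C : R).
Hypothesis e1 : dot e e = 1.
Hypothesis u_ge : forall x, eball rad x -> m <= u x.
Hypothesis L_gt0 : 0 < L.
Hypothesis g_lip : forall s t, m <= s -> s <= t -> g s - g t <= L * (t - s).
Hypotheses (r0_gt0 : 0 < r0) (r0_lt : r0 < rad).
Hypothesis u_large : forall x, r0 <= enorm x < rad -> b < u x.
Hypothesis u_mono : forall x y, enorm x < enorm y -> r0 <= enorm y < rad ->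
  u x <= u y + C.

Let A : R := L + 1.
Let rad_gt0 := radius_gt0 sol.

Lemma reflect_in_ball k x : 0 < k -> cap rad e k x -> eball rad (mirror e k x).
Proof.
move=> k0 [xR kx]; exact: lt_trans (enorm_reflect_lt e1 k0 kx) xR.
Qed.

(* The concave weight [psi = 1 + A * t * (2 * rad - t)], with [t] the distance to
   the plane, satisfies [laplacian psi < - L * psi] in the slab [t < d]; away
   from the slab only points near the sphere are left, where [g] is monotone. *)
Lemma cap_gap_le0 k d : 0 < k -> k < rad -> 2 * A * rad * d <= 1 ->
  (forall x, enorm x <= r0 -> k + d <= dot x e -> gap u e k x <= 0) ->
  forall x, cap rad e k x -> gap u e k x <= 0.
Proof.
move=> k0 kR dsmall core xs [xsR xsk]; rewrite leNgt; apply/negP => big.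
have A0 : 0 < A by rewrite /A addr_gt0.
pose psi x := 1 + A * (2 * rad * (dot x e - k) - (dot x e - k) ^+ 2).
have t_lt x : enorm x < rad -> dot x e - k < rad.
  by move=> xR; have := dot_le_enorm x e1; move: xR k0; lra.
have psi1 x : enorm x < rad -> k <= dot x e -> 1 <= psi x.
  move=> /t_lt tR kx; have : 0 <= dot x e - k by rewrite subr_ge0.
  rewrite /psi => t0; move: (dot x e - k) tR t0 => t tR t0.
  rewrite lerDl mulr_ge0 ?(ltW A0)// expr2 -mulrBl.
  by rewrite mulr_ge0//; move: tR rad_gt0; lra.
pose f x := gap u e k x / psi x.
have fxs : 0 < f xs by rewrite divr_gt0// (lt_le_trans _ (psi1 _ xsR (ltW xsk))).
have K0 := corner_slope_gt0 C r0_gt0 r0_lt; set K' := corner_slope rad r0 C in K0.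
(* For [|x| > rho] the corner bound is at most [2 * rad * K' * (rad - |x|)], hence at most [f xs];
   as [psi >= 1], such points cannot raise the maximum of [f]. *)
pose rho := Num.max (Num.max r0 (enorm xs)) (rad - f xs / (2 * rad * K')).
have [rho1 rho2 rho3] : [/\ r0 <= rho, enorm xs <= rho & rad - f xs / (2 * rad * K') <= rho].
  by rewrite !le_max !lexx !orbT.
have q0 : 0 < f xs / (2 * rad * K').
  by apply: divr_gt0 => //; apply: mulr_gt0 => //; apply: mulr_gt0.
have rhoR : rho < rad by rewrite !gt_max r0_lt xsR/= gtrBl.
pose Kc := [set x : 'rV[R]_N | [/\ 0 <= enorm x, enorm x <= rho & k <= dot x e]].
pose S := [set x : 'rV[R]_N | enorm x < rad /\ k <= dot x e].
have [x [_ x2 x3]||x [_ x2 x3]|x [x1 x2] nKx|x0 [_ z1 z2] fmax] :=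
  @max_outside_compact R _ f Kc S xs (@compact_closed_cap R N e 0 rho k).
- by split => //; exact: le_lt_trans rhoR.
- by split => //; [exact: enorm_ge0|exact: ltW].
- have xR : enorm x < rad by exact: le_lt_trans rhoR.
  have cst_x l : (fun=> l) @ nbhs x --> (l : R) by exact: cvg_cst.
  have tx : dot y e - k @[y --> x] --> dot x e - k.
    exact: (cvgB (@dot_continuousr R N e x) (cst_x k)).
  have psiC : psi y @[y --> x] --> psi x.
    exact: (cvgD (cst_x 1) (cvgM (cst_x A) (cvgB (cvgM (cst_x (2 * rad)) tx) (cvgM tx tx)))).
  have psin : psi x != 0 by rewrite gt_eqF// (lt_le_trans _ (psi1 x xR x3)).
  exact: (cvgM (gap_continuous sol e1 k0 xR x3) (cvgV psin psiC)).
- have psix := psi1 x x1 x2.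
  rewrite ler_pdivrMr ?(lt_le_trans _ psix)//.
  apply: (@le_trans _ _ (f xs)); last by rewrite ler_peMr// ltW.
  move: x2; rewrite le_eqVlt => /orP[/eqP xk|xk].
    by rewrite (gap_fixed u (esym xk)) ltW.
  have xrho : rho < enorm x.
    rewrite ltNge; apply/negP => xrho; apply: nKx; split => //; first exact: enorm_ge0.
    exact: ltW.
  have := corner_bound sol e1 r0_gt0 r0_lt u_large u_mono k0 (conj x1 xk)
    (le_trans rho1 (ltW xrho)).
  move=> /le_trans; apply; rewrite -/K' -enorm_sqr.
  have -> : f xs = K' * (2 * rad * (f xs / (2 * rad * K'))).
    by field; rewrite !gt_eqF.
  rewrite ler_pM2l// subr_sqr mulrC; apply: ler_pM.
  - by rewrite addr_ge0 ?enorm_ge0// ltW.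
  - by rewrite subr_ge0 ltW.
  - by move: x1; lra.
  - by move: xrho rho3; lra.
have x0R : enorm x0 < rad by exact: le_lt_trans rhoR.
have psi0 := psi1 x0 x0R z2; have psi_gt0 : 0 < psi x0 by exact: lt_le_trans psi0.
have f0 : 0 < f x0 by apply: lt_le_trans fxs _; apply: fmax; split => //; exact: ltW.
have gE : gap u e k x0 = f x0 * psi x0 by rewrite divfK// gt_eqF.
have g0 : 0 < gap u e k x0 by rewrite gE mulr_gt0.
have {}z2 : k < dot x0 e.
  rewrite lt_neqAle z2 andbT; apply/eqP => E.
  by move: g0; rewrite (gap_fixed u (esym E)) ltxx.
have uu : u x0 < u (mirror e k x0) by rewrite -subr_gt0.
(* No quotient is differentiated: on the cap [gap - f x0 * psi] has maximum zero, attained at [x0],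
   and [psi] has Laplacian [- 2 * A]. *)
have lap : g (u (mirror e k x0)) - g (u x0) <= - (2 * A * f x0).
  have psilap : has_laplacian psi x0 (0 + A * (2 * rad * 0 - 2 * dot e e)).
    apply: has_laplacianD; first exact: has_laplacian_cst.
    apply: has_laplacianZ; apply: has_laplacianB.
      exact/has_laplacianZ/has_laplacian_affine.
    exact: has_laplacian_affine_sqr.
  have := has_laplacianB (gap_laplacian sol e1 k0 x0R (ltW z2)) (has_laplacianZ (f x0) psilap).
  move=> /has_laplacian_max hmax.
  have : g (u (mirror e k x0)) - g (u x0)
     - f x0 * (0 + A * (2 * rad * 0 - 2 * dot e e)) <= 0.
    apply: hmax; have : nbhs x0 (cap rad e k).
      by apply: open_nbhs_nbhs; split; [exact: cap_open|].
    apply: filterS => y [y1 y2]; rewrite -gE subrr subr_le0.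
    rewrite -ler_pdivrMr ?(lt_le_trans _ (psi1 y y1 (ltW y2)))//.
    by apply: fmax; split => //; exact: ltW.
  by rewrite e1; lra.
have Af : 0 < 2 * A * f x0.
  by apply: mulr_gt0 => //; apply: mulr_gt0.
have [out|inn] := ltP r0 (enorm x0).
  have ub : b <= u x0 by apply/ltW/u_large; rewrite x0R ltW.
  by have := large_ndecr sol ub (ltW uu); move: lap Af; lra.
have [far|near] := leP (k + d) (dot x0 e).
  by have := core x0 inn far; rewrite leNgt g0.
have := g_lip (u_ge x0R) (ltW uu); rewrite -/(gap u e k x0) gE => lip.
(* The slab is thin enough for this bound; the one-sided Lipschitz estimate then gives at least
   [- 2 * L * f x0] for the difference in [lap], too much since [A = L + 1]. *)
have psi2 : psi x0 <= 2.
  rewrite /psi; have t0 : 0 < dot x0 e - k by rewrite subr_gt0.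
  have : A * (2 * rad * (dot x0 e - k)) <= A * (2 * rad * d).
    by rewrite ler_pM2l// ler_pM2l ?mulr_gt0//; move: near; lra.
  have : 0 <= A * (dot x0 e - k) ^+ 2 by rewrite mulr_ge0 ?sqr_ge0// ltW.
  by move: dsmall; lra.
have : L * (f x0 * psi x0) <= L * (f x0 * 2) by rewrite !ler_pM2l.
by move: lap lip f0; rewrite /A; lra.
Qed.

(** The cap is convex, so a tube about the segment from one point of strict negativity to [q] stays
    inside it and away from the sphere. There [g] is Lipschitz on the values of [u], and the strong
    minimum principle applies to minus the gap. *)
Lemma cap_gap_lt0 k : 0 < k -> k < rad ->
  (forall x, cap rad e k x -> gap u e k x <= 0) ->
  forall x, cap rad e k x -> gap u e k x < 0.
Proof.
move=> k0 kR gle q [qR kq].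
have N0 := dim_gt0 sol.
have ee : enorm e = 1 by apply: enorm_eqr_sqr; rewrite ?e1 ?expr1n.
have te s : enorm (s *: e) = `|s| by rewrite enormZ ee mulr1.
(* Far out on the axis [u] exceeds its values at the reflected points. *)
have [p [[pR kp] p0]] : exists p, cap rad e k p /\ gap u e k p < 0.
  (* For [(k + rad) / 2 <= s < rad] the reflected point [(2 * k - s) *: e] has norm at most [r1]. *)
  pose r1 := Num.max (rad - 2 * k) (2 * k - (k + rad) / 2).
  have r1R : r1 < rad by rewrite gt_max; apply/andP; split; move: k0 kR; lra.
  have [U UP] := solution_bounded sol r1R.
  have [rh /andP[rh0 rhR] rhP] := blows_up_atP U rad_gt0 (solution_blow_up sol).
  pose s := Num.max rh ((k + rad) / 2).
  have [s1 s2] : rh <= s /\ (k + rad) / 2 <= s by rewrite !le_max !lexx orbT.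
  have sR : s < rad by rewrite gt_max rhR/=; move: kR; lra.
  have s0 : 0 < s by move: k0 kR s2; lra.
  have re : mirror e k (s *: e) = (2 * k - s) *: e.
    by rewrite /mirror dotZl e1 -scalerBl; congr (_ *: _); ring.
  exists (s *: e); split.
    by split; rewrite ?te ?gtr0_norm// dotZl e1 mulr1; move: s2 kR; lra.
  rewrite /gap re subr_lt0; apply: (@le_lt_trans _ _ U).
    have [a1 a2] : rad - 2 * k <= r1 /\ 2 * k - (k + rad) / 2 <= r1.
      by rewrite !le_max !lexx orbT.
    apply: UP; rewrite te ler_norml; apply/andP; split.
      by move: a1 sR; lra.
    by move: a2 s2; lra.
  by apply: rhP; rewrite te gtr0_norm// s1.
have Cp : cap rad e k p by [].
have Cq : cap rad e k q by [].
pose r1 := Num.max (enorm p) (enorm q).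
have [p1 q1] : enorm p <= r1 /\ enorm q <= r1 by rewrite !le_max !lexx orbT.
have r1R : r1 < rad by rewrite gt_max pR.
pose r2 := (r1 + rad) / 2.
have r2R : r2 < rad by rewrite /r2; lra.
have [U UP] := solution_bounded sol r2R.
have [M M0 MP] := rhs_lipschitz sol m U.
have gC : {for p, continuous (gap u e k)} := gap_continuous sol e1 k0 pR (ltW kp).
have [d d0 dP] : exists2 d : R, 0 < d & forall x, enorm (x - p) <= d -> gap u e k x < 0.
  have : \forall x \near p, gap u e k x < 0 by exact: (cvgr_lt _ gC).
  move=> /nbhs_ballP[d /= d0 dP]; exists (d / 2); first by rewrite divr_gt0.
  move=> x xp; apply: dP; rewrite -ball_normE/= distrC.
  apply: le_lt_trans (rV_norm_le_enorm _) _; apply: le_lt_trans xp _.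
  by move: d0; lra.
pose gapm := Num.min (dot p e - k) (dot q e - k).
have gapm0 : 0 < gapm by rewrite lt_min !subr_gt0 kp.
have [gm1 gm2] : gapm <= dot p e - k /\ gapm <= dot q e - k.
  by rewrite !ge_min !lexx orbT.
(* The bound [d] gives strict negativity on the ball about [p]; the last two keep the tube beyond
   the hyperplane and within radius [r2]. *)
pose rho := Num.min (Num.min 1 d) (Num.min (gapm / 2) ((rad - r1) / 2)).
have rho0 : 0 < rho by rewrite !lt_min ltr01 d0 !divr_gt0// subr_gt0.
have [h1 h2 h3 h4] : [/\ rho <= 1, rho <= d, rho <= gapm / 2 & rho <= (rad - r1) / 2].
  by rewrite !ge_min !lexx !orbT.
rewrite -oppr_gt0.
apply: (@strong_minimum_principle R N (fun x => - gap u e k x) p q rho M) => //.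
- by rewrite rho0.
- exact: ltW.
- move=> t x /andP[t0 t1] xt.
  pose h := x - (p + t *: (q - p)).
  have xE : x = h + ((1 - t) *: p + t *: q).
    by rewrite /h; apply/rowP => i; rewrite !mxE; ring.
  rewrite -/h in xt; move: h xE xt => h xE xt.
  have xr : enorm x <= r2.
    rewrite xE; apply: le_trans (enormD _ _) _.
    apply: (@le_trans _ _ (rho + ((1 - t) * r1 + t * r1))).
      apply: lerD xt _; apply: le_trans (enormD _ _) _.
      rewrite !enormZ !ger0_norm ?subr_ge0//.
      by apply: lerD; rewrite ler_wpM2l ?subr_ge0.
    by rewrite /r2; move: h4; lra.
  have xR : enorm x < rad by exact: le_lt_trans r2R.
  have xk : k < dot x e.
    rewrite xE !dotE.
    have he : - dot h e <= rho.
      rewrite -dotNl; apply: le_trans (dot_le_enorm _ e1) _.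
      by rewrite enormN.
    have : (1 - t) * (k + gapm) <= (1 - t) * dot p e.
      by rewrite ler_wpM2l ?subr_ge0//; move: gm1; lra.
    have : t * (k + gapm) <= t * dot q e by rewrite ler_wpM2l//; move: gm2; lra.
    by move: h3 he gapm0; lra.
  have Cx : cap rad e k x by [].
  have Tx := reflect_in_ball k0 Cx.
  have gx := gle x Cx.
  have uTu : u (mirror e k x) <= u x by rewrite -subr_le0.
  split; first by rewrite oppr_ge0.
    by apply: (@cvgN _ _ _ (nbhs x)); exact: (gap_continuous sol e1 k0 xR (ltW xk)).
  exists (- (g (u (mirror e k x)) - g (u x))).
    exact/has_laplacianN/(gap_laplacian sol e1 k0 xR (ltW xk)).
  rewrite opprB; apply: le_trans (ler_norm _) _.
  have uxU : u x <= U by exact: UP.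
  apply: le_trans (MP _ _ _ _) _; rewrite ?u_ge ?uxU//.
    exact: le_trans uTu uxU.
  by rewrite /gap opprB ger0_norm// subr_ge0.
- by move=> x xp; rewrite oppr_gt0; apply: dP; exact: le_trans h2.
Qed.

(** On the compact part of the cap with [|x| <= r0] and distance at least [d / 2] from the
    hyperplane, strict negativity persists for nearby [k]. If also [k0 - k < d / 2], the rest of the
    inner ball lies in the slab of width [d] that [cap_gap_le0] absorbs. The case [k0 = rad] is
    included. *)
Lemma cap_gap_open_left k0 : 0 < k0 -> k0 <= rad ->
  (forall x, cap rad e k0 x -> gap u e k0 x < 0) ->
  \forall k \near k0, 0 < k -> k < k0 ->
     forall x, cap rad e k x -> gap u e k x <= 0.
Proof.
move=> k00 k0R glt.
have A0 : 0 < A by rewrite /A addr_gt0.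
pose d := (2 * A * rad)^-1.
have d0 : 0 < d by rewrite invr_gt0; apply: mulr_gt0 => //; apply: mulr_gt0.
pose K := [set x : 'rV[R]_N | [/\ 0 <= enorm x, enorm x <= r0 & k0 + d / 2 <= dot x e]].
have /compact_near_coveringP/(_ R (nbhs k0) (fun k x => gap u e k x < 0)) :=
  @compact_closed_cap R N e 0 r0 (k0 + d / 2).
case=> [x [_ x1 x2]|dl /= dl0 dlP].
  have xR : enorm x < rad by exact: le_lt_trans r0_lt.
  have xk : k0 < dot x e by move: x2 d0; lra.
  have gx : gap u e k0 x < 0 by apply: glt.
  have cv : gap u e z.2 z.1 @[z --> filter_prod (nbhs x) (nbhs k0)] --> gap u e k0 x.
    apply: (gap_cvg sol e1 (kk := snd) (xx := fst)) => //; last exact: ltW.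
      exact: cvg_snd.
    exact: cvg_fst.
  exact: (cvgr_lt _ cv _ gx).
exists (Num.min dl (d / 2)) => /=; first by rewrite lt_min dl0 divr_gt0.
move=> k /=; rewrite lt_min => /andP[kdl kd] k_gt0 kk0.
apply: (cap_gap_le0 (d := d)) => //; first exact: lt_le_trans k0R.
  by rewrite /d mulfV// gt_eqF// -invr_gt0.
move=> x xr xd; apply: ltW; apply: (dlP k kdl); split => //; first exact: enorm_ge0.
by move: xd kd; rewrite gtr0_norm ?subr_gt0//; lra.
Qed.

(** Let [k0] be the supremum of the positions with a positive gap somewhere. The gap is nonpositive
    above [k0], at [k0] by a right limit, and then strictly negative there; moving slightly to the
    left contradicts the supremum. *)
Lemma cap_gap_lt0_all k : 0 < k -> k < rad ->
  forall x, cap rad e k x -> gap u e k x < 0.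
Proof.
move=> k_gt0 kR; apply: cap_gap_lt0 => // x Cx; rewrite leNgt; apply/negP => gx.
pose S := [set k | [/\ 0 < k, k < rad & exists2 x, cap rad e k x & 0 < gap u e k x]].
have Sk : S k by split => //; exists x.
have Sub : ubound S rad by move=> l [_ /ltW].
have supS : has_sup S by split; [exists k|exists rad].
pose k0 := sup S.
have le_k0 l : S l -> l <= k0 by exact: (sup_upper_bound supS).
have k0k := le_k0 _ Sk.
have k00 : 0 < k0 by exact: lt_le_trans k0k.
have k0R : k0 <= rad by apply: ge_sup => //; exists k.
have above l : k0 < l -> l < rad -> forall y, cap rad e l y -> gap u e l y <= 0.
  move=> k0l lR y Cy; rewrite leNgt; apply/negP => gy.
  have : l <= k0; last by rewrite leNgt k0l.
  by apply: le_k0; split; [exact: lt_trans k0l| |exists y].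
have at_k0 : k0 < rad -> forall y, cap rad e k0 y -> gap u e k0 y <= 0.
  move=> k0R' y [yR yk].
  have cv : gap u e l y @[l --> k0^'+] --> gap u e k0 y.
    apply: (gap_cvg sol e1 (kk := id) (xx := fun=> y)) => //; last exact: ltW.
      exact: cvg_at_right_filter cvg_id.
    exact: cvg_cst.
  rewrite leNgt; apply/negP => gy.
  near k0^'+ => l.
  have : 0 < gap u e l y by near: l; exact: (cvgr_gt _ cv).
  rewrite ltNge => /negP; apply; apply: above.
  - by near: l; exact: nbhs_right_gt.
  - by near: l; exact: nbhs_right_lt.
  - by split => //; near: l; exact: nbhs_right_lt.
(* If [k0 = rad] the cap is empty and the claim is vacuous. *)
have strict y : cap rad e k0 y -> gap u e k0 y < 0.
  move=> Cy; have k0R' : k0 < rad.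
    by case: Cy => yR yk; apply: lt_le_trans yk (le_trans (dot_le_enorm _ e1) (ltW yR)).
  by apply: cap_gap_lt0 Cy => //; exact: at_k0.
have [d /= d0 dP] := cap_gap_open_left k00 k0R strict.
have [l Sl lk] := sup_adherent d0 supS.
have [l0 lR [y Cy gy]] := Sl.
have lk0 := le_k0 _ Sl.
have : gap u e l y <= 0; last by rewrite leNgt gy.
move: lk0; rewrite le_eqVlt => /orP[/eqP lE|lk0].
  by apply/ltW; rewrite lE; apply: strict; rewrite -lE.
apply: (dP l) => //=; rewrite gtr0_norm ?subr_gt0//.
by move: lk; rewrite -/k0; lra.
Unshelve. all: by end_near. Qed.

End fixed_direction.
End moving_planes.

(** * Radial symmetry and monotonicity *)

Lemma large_solution_gap_lt0 (R : realType) (N : nat) (rad : R) (g : R -> R)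
    (u : 'rV[R]_N -> R) (b c : R) (e : 'rV[R]_N) (k : R) :
  large_solution rad g u b c -> dot e e = 1 -> 0 < k -> k < rad ->
  forall x, cap rad e k x -> gap u e k x < 0.
Proof.
move=> sol e1 k0 kR.
have [m mP] := blow_up_bounded_below (radius_gt0 sol) (solution_continuous sol)
  (solution_blow_up sol).
have [L L0 LP] := rhs_one_sided_lipschitz sol m.
have [r0 [C [r00 r0R ularge umono]]] := two_point_bound sol.
exact: (cap_gap_lt0_all sol e1 mP L0 LP r00 r0R ularge umono k0 kR).
Qed.

(** The hyperplane through the centre normal to [y - x] exchanges the two points. The strict
    inequality holds for its translates with small [k > 0], and [k] tends to 0. Exchanging [x] and
    [y] gives equality. *)
Lemma large_solution_radial (R : realType) (N : nat) (rad : R) (g : R -> R)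
    (u : 'rV[R]_N -> R) (b c : R) (x y : 'rV[R]_N) :
  large_solution rad g u b c -> enorm x = enorm y -> eball rad y -> u x <= u y.
Proof.
move=> sol xy By.
have [->//|xny] := eqVneq x y.
have yx0 : 0 < enorm (y - x).
  rewrite lt0r enorm_ge0 andbT; apply: contra_neq xny => /enorm_eq0/eqP.
  by rewrite subr_eq0 => /eqP.
have xy2 : dot x x = dot y y by rewrite -!enorm_sqr xy.
pose e := (enorm (y - x))^-1 *: (y - x).
have d2 : dot y y - dot x y = enorm (y - x) ^+ 2 / 2.
  by rewrite enorm_sqr !dotE (dotC y x) xy2; field.
have e1 : dot e e = 1.
  by rewrite /e dotZl dotZr -enorm_sqr; field; rewrite gt_eqF.
have yeE : dot y e = enorm (y - x) / 2.
  have -> : dot y e = (enorm (y - x))^-1 * (dot y y - dot x y).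
    by rewrite /e dotZr !dotE (dotC y x).
  by rewrite d2; field; rewrite gt_eqF.
have rx : mirror e 0 y = x.
  rewrite /mirror yeE subr0 /e scalerA (_ : 2 * _ / _ = 1).
    by rewrite scale1r opprB addrC subrK.
  by field; rewrite gt_eqF.
have Bx : eball rad x by move: By; rewrite /eball/= xy.
have cst_e : (fun=> y) @ (0 : R)^'+ --> y by exact: cvg_cst.
have id0 : k @[k --> (0 : R)^'+] --> (0 : R) by exact: cvg_at_right_filter cvg_id.
have cv : u (mirror e k y) @[k --> (0 : R)^'+] --> u x.
  apply: (cvg_comp (fun k => mirror e k y) u).
    exact: (cvg_reflect _ id0 cst_e).
  by rewrite rx; exact: (solution_continuous sol).
rewrite leNgt; apply/negP => uyx.
near (0 : R)^'+ => k.
have : u y < u (mirror e k y) by near: k; exact: (cvgr_gt _ cv).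
rewrite ltNge => /negP; apply; rewrite -subr_le0; apply: ltW.
apply: (large_solution_gap_lt0 sol e1).
- by near: k; exact: nbhs_right_gt.
- by near: k; apply: nbhs_right_lt; exact: radius_gt0 sol.
- split => //; near: k; apply: nbhs_right_lt.
  by rewrite yeE divr_gt0.
Unshelve. all: by end_near. Qed.

Lemma large_solution_radial_increasing (R : realType) (N : nat) (rad : R)
    (g : R -> R) (u : 'rV[R]_N -> R) (b c : R) :
  large_solution rad g u b c -> radial_increasing rad u.
Proof.
move=> sol; pose e : 'rV[R]_N := basis_vec R (Ordinal (dim_gt0 sol)).
have e1 : dot e e = 1 by rewrite dot_basis basis_diag.
have ee : enorm e = 1 by apply: enorm_eqr_sqr; rewrite ?e1 ?expr1n.
have te s : enorm (s *: e) = `|s| by rewrite enormZ ee mulr1.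
exists (fun r => u (r *: e)).
  move=> x Bx; have xE : enorm (enorm x *: e) = enorm x.
    by rewrite te ger0_norm// enorm_ge0.
  apply/eqP; rewrite eq_le !(large_solution_radial sol)//.
  by rewrite /eball/= xE.
move=> r s /[!in_itv]/= /andP[r0 rR] /andP[s0 sR] rs.
(* The hyperplane halfway between [r *: e] and [s *: e] reflects the second onto the first, so
   strict growth is the sign of the gap at a single point; [k > 0] because [0 <= r < s]. *)
pose k := (r + s) / 2.
have kP : 0 < k /\ k < s by rewrite /k; split; lra.
have re : mirror e k (s *: e) = r *: e.
  by rewrite /mirror dotZl e1 -scalerBl; congr (_ *: _); rewrite /k; field.
rewrite -re -subr_lt0; apply: (large_solution_gap_lt0 sol e1); [lra|lra|].
by split; rewrite ?te ?ger0_norm// dotZl e1 mulr1; lra.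
Qed.


Theorem theorem1p1 (R : realType) (N : nat) (rad : R) (g : R -> R)
    (u : 'rV[R]_N -> R) :
  (2 <= N)%N -> 0 < rad ->
  locally_lipschitz g ->
  (exists a : R, [/\ 0 < a,
     {in `[a, +oo[, forall s, 0 < g s} &
     convex_function (`[a, +oo[%classic : set R) g]) ->
  keller_osserman g ->
  C2_on (eball rad) u ->
  (forall x, eball rad x -> - laplacian u x + g (u x) = 0) ->
  blows_up_at rad u ->
  radial_increasing rad u.
Proof.
move=> N2 rad0 glip [a [a0 gpos gconv]] _ uC2 eqn ublow.
have N0 : (0 < N)%N by exact: ltn_trans N2.
have uE x : eball rad x -> laplacian u x = g (u x).
  by move=> /eqn/eqP; rewrite addrC subr_eq0 => /eqP.
have [b [c [ab c0 gc]]] : exists b c, [/\ a <= b, 0 < c &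
    forall x y, b <= x -> x <= y -> c * (y - x) <= g y - g x].
  (* Without a rising chord [g] is at most [g a] beyond [a]. Since [u] is bounded below, the
     Lipschitz bound controls the values below [a], so the Laplacian of [u] would be bounded
     above. *)
  apply: (convex_growth gconv); apply: contrapT => noinc.
  have gdecr s : a <= s -> g s <= g a.
    rewrite le_eqVlt => /orP[/eqP->//|as_]; rewrite leNgt; apply/negP => gas.
    by apply: noinc; exists a, s.
  have [m mP] := blow_up_bounded_below rad0 (fun x Bx => proj1 (uC2.1 x Bx)) ublow.
  have [L L0 LP] := locally_lipschitz_itv m a glip.
  apply: (large_solution_rhs_unbounded (C := g a + L * `|a - m|) N0 rad0 uC2 ublow uE).
  move=> x Bx; have mu := mP x Bx.
  have LC : 0 <= L * `|a - m| by rewrite mulr_ge0// ltW.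
  have [/gdecr|ua] := leP a (u x); first by move: LC; lra.
  have ma : m <= a by lra.
  rewrite -lerBlDl; apply: le_trans (ler_norm _) _.
  have lip : `|g (u x) - g a| <= L * `|u x - a|.
    by apply: LP; rewrite ?mu ?ma ?lexx ?(ltW ua).
  apply: le_trans lip _; rewrite ler_pM2l// distrC !ger0_norm ?subr_ge0 ?(ltW ua)//.
  by rewrite lerD2l lerN2.
apply: (@large_solution_radial_increasing R N rad g u b c).
split => //.
- by apply: gpos; rewrite in_itv/= ab.
- by move=> x y bx xy; apply: (convex_function_slope gconv).
- by move=> m M; exact: locally_lipschitz_itv.
Qed.
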